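(* Let $X$ be a Banach space with norm $\|\cdot\|$, let $T>0$ and $u_0\in X$. Suppose that $F\in C^{6}([0,T]\times X,X)$ is Lipschitz with respect to its second variable, i.e. there exists $\mu\geq 0$ such that $$\|F(t,x)-F(t,y)\|\leq \mu\|x-y\|\qquad\text{for all }(t,x,y)\in[0,T]\times X\times X,$$ and that the Cauchy problem $$\frac{du}{dt}=F(t,u),\quad t\in[0,T],\qquad u(0)=u_0,$$ has a unique solution $u\in C^{7}([0,T],X)$. For a positive integer $N$, let $k=T/N$ and $t_n=nk$, $n=0,1,\dots,N$, and let $\{u^{6,n}\}_{n=0}^N$ be the sequence given by the hybrid deferred correction scheme DC6RK2/4 with step $k$. Then, provided $k$ is sufficiently small, $\{u^{6,n}\}_{n=0}^N$ approximates $u(t_n)$ with order 6 of accuracy on the partition $0=t_0<\cdots<t_N=T$; that is, there is a constant $C$ independent of $k$ and $n$ such that, for all sufficiently small $k=T/N$, $$\|u^{6,n}-u(t_n)\|\leq Ck^6,\qquad n=0,1,\dots,N.$$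
   Context: Notation: $t_{n+\lambda}=(n+\lambda)k$ for real $\lambda\ge 0$. The scheme DC6RK2/4 (hybrid deferred correction of the explicit midpoint rule by RK4) is defined as follows. Set $u^{6,0}=u_0$. For $n=0,1,\dots,N-1$, given $u^{6,n}$: (1) Let $h=k/5$ and $u^{4,n,0}=u^{6,n}$, and compute $u^{4,n,1},\dots,u^{4,n,5}$, which approximate $u(t_{n+i/5})$, $i=1,\dots,5$, by five successive steps of size $h$ of the classical fourth-order Runge-Kutta method: for $i=0,\dots,4$, with $s_i=t_n+ih$ and $v_i=u^{4,n,i}$, $$u^{4,n,i+1}=v_i+\frac{h}{6}(K_1+2K_2+2K_3+K_4),$$ $$K_1=F(s_i,v_i),\quad K_2=F\left(s_i+\tfrac h2,v_i+\tfrac h2K_1\right),\quad K_3=F\left(s_i+\tfrac h2,v_i+\tfrac h2K_2\right),\quad K_4=F(s_i+h,v_i+hK_3).$$ (2) Set $$a_n=\frac{125}{384}\left(-3u^{4,n,0}-u^{4,n,1}+18u^{4,n,2}-18u^{4,n,3}+u^{4,n,4}+3u^{4,n,5}\right),$$ $$b_n=\frac{25}{768}\left(145u^{4,n,0}-387u^{4,n,1}+402u^{4,n,2}-238u^{4,n,3}+93u^{4,n,4}-15u^{4,n,5}\right).$$ (3) Set $$u^{6,n+1}=u^{6,n}+a_n+kF\left(t_{n+\frac12},\,u^{6,n}+\frac{k}{2}F(t_n,u^{6,n})+b_n\right).$$ *)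

(* Defs.v *)
From HB Require Import structures.
From mathcomp Require Import all_boot all_order all_algebra.
From mathcomp Require Import all_classical all_reals all_analysis.
Set Implicit Arguments.
Unset Strict Implicit.
Unset Printing Implicit Defensive.
Import Order.TTheory GRing.Theory Num.Theory.
Import numFieldNormedType.Exports.
Local Open Scope classical_set_scope.
Local Open Scope ring_scope.

(* Elements of L^j(E; G), the bounded j-linear maps from E to G, are          *)
(* represented by functions on ('I_j -> E). The operator norm is not built    *)
(* as a function: [opnorm_le c A] says that it is at most c.                  *)
Definition multilinear_map (R : realType) (E G : normedModType R) (j : nat)
    (A : ('I_j -> E) -> G) : Prop :=
  forall (h : 'I_j -> E) (i : 'I_j) (a : R) (x y : E),
    A [eta h with i |-> a *: x + y] =
    a *: A [eta h with i |-> x] + A [eta h with i |-> y].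

Definition opnorm_le (R : realType) (E G : normedModType R) (j : nat) (c : R)
    (A : ('I_j -> E) -> G) : Prop :=
  forall h : 'I_j -> E, `|A h| <= c * \prod_(i < j) `|h i|.

Definition cons_arg (E : Type) (j : nat) (v : E) (h : 'I_j -> E)
    (i : 'I_j.+1) : E :=
  if unlift ord0 i is Some i' then h i' else v.

(* f is of class C^m on D, in the sense of Frechet: Df j x is the j-th        *)
(* derivative D^j f(x) in L^j(E; G), with                                     *)
(*   D^(j+1) f(x) (v, h_1, ..., h_j) = (D (D^j f)(x) v) (h_1, ..., h_j).      *)
(* Differentiability and continuity are relative to D, hence one-sided at     *)
(* boundary points of D. It is meant for convex D with nonempty interior, for *)
(* which these derivatives are unique.                                        *)
Definition class_C (R : realType) (E G : normedModType R) (m : nat)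
    (D : set E) (f : E -> G) : Prop :=
  exists Df : forall j : nat, E -> ('I_j -> E) -> G,
  [/\ forall x, D x -> forall h, Df 0%N x h = f x,
      forall j x, (j <= m)%N -> D x ->
        multilinear_map (Df j x) /\ exists M : R, opnorm_le M (Df j x),
      forall j x, (j < m)%N -> D x -> forall eps : R, 0 < eps ->
        \forall y \near within D (nbhs x),
          opnorm_le (eps * `|y - x|)
            (fun h => Df j y h - Df j x h - Df j.+1 x (cons_arg (y - x) h))
    & forall x, D x -> forall eps : R, 0 < eps ->
        \forall y \near within D (nbhs x),
          opnorm_le eps (fun h => Df m y h - Df m x h)].

(* The derivative is relative to [0, T], hence one-sided at 0 and T. *)
Definition cauchy_solution (R : realType) (X : normedModType R) (T : R)
    (F : R * X -> X) (u0 : X) (u : R -> X) : Prop :=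
  u 0 = u0 /\
  forall t, t \in `[0, T] ->
    (fun s => (s - t)^-1 *: (u s - u t)) @ within [set` `[0, T]] t^'
      --> F (t, u t).

Section Scheme.
Variables (R : realType) (X : normedModType R) (F : R * X -> X).

Definition rk4_step (h s : R) (v : X) : X :=
  let K1 := F (s, v) in
  let K2 := F (s + h / 2, v + (h / 2) *: K1) in
  let K3 := F (s + h / 2, v + (h / 2) *: K2) in
  let K4 := F (s + h, v + h *: K3) in
  v + (h / 6) *: (K1 + 2 *: K2 + 2 *: K3 + K4).

Fixpoint rk4 (h t : R) (v : X) (i : nat) : X :=
  if i is i'.+1 then rk4_step h (t + i'%:R * h) (rk4 h t v i') else v.

(* For w i = u (t + i k / 5), dc_a w approximates                             *)
(* u (t + k) - u t - k u'(t + k / 2), and dc_b w approximates                 *)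
(* u (t + k / 2) - u t - (k / 2) u'(t).                                       *)
Definition dc_a (w : nat -> X) : X :=
  (125 / 384) *:
  ((- 3) *: w 0%N - w 1%N + 18 *: w 2%N - 18 *: w 3%N + w 4%N + 3 *: w 5%N).

Definition dc_b (w : nat -> X) : X :=
  (25 / 768) *:
  (145 *: w 0%N - 387 *: w 1%N + 402 *: w 2%N - 238 *: w 3%N + 93 *: w 4%N
   - 15 *: w 5%N).

Definition dc6rk24_step (k t : R) (v : X) : X :=
  let w := rk4 (k / 5) t v in
  v + dc_a w
    + k *: F (t + k / 2, v + (k / 2) *: F (t, v) + dc_b w).

Fixpoint dc6rk24 (k : R) (u0 : X) (n : nat) : X :=
  if n is n'.+1 then dc6rk24_step k (n'%:R * k) (dc6rk24 k u0 n') else u0.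

End Scheme.

(* Main.v *)
Require Import Defs.
From HB Require Import structures.
From mathcomp Require Import all_boot all_order all_algebra.
From mathcomp Require Import all_classical all_reals all_analysis.
From mathcomp Require Import ring lra zify.
Set Implicit Arguments.
Unset Strict Implicit.
Unset Printing Implicit Defensive.
Import Order.TTheory GRing.Theory Num.Theory.
Import numFieldNormedType.Exports.
Local Open Scope classical_set_scope.
Local Open Scope ring_scope.

(** One step of the scheme, started from the exact solution, is wrong by
    O(k^7) ([local_error]), and it is a (1 + c k)-Lipschitz map of its initial
    value ([dc6rk24_step_stable]). The error of order 6 follows by summing the
    local errors over the [N = T / k] steps, amplified at most by [exp (c T)].

    The point is the local error. The five Runge-Kutta substeps of size
    [h = k / 5] give values [u (t + i h) + e i] with [e i] only O(h^5), whereas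
    [dc_a] must be computed up to O(h^7). What saves two orders is that the error
    is a smooth function of the rank [i] of the substep: its first, second and
    third differences are O(h^5), O(h^6) and O(h^7). The functional [dc_a], which
    approximates a third derivative, is a combination of third differences, and
    [dc_b], which is multiplied by [k], one of second differences; both therefore
    damp the error enough ([dc_rk4_error]). On the exact solution they have the
    right order by Taylor's formula ([dc_a_exact], [dc_b_exact]).

    Smoothness in [i] is expressed by the predicate [diffO]: [m] successive
    differences, each of which gains a power of the step. It is stable under
    linear combinations and under multilinear maps ([diffO_multilinear]), hence,
    by Taylor's formula at the point [(t, u t)], under mixed second differences
    of the vector field ([diffO_mixed]). Exact values of [u] and [u'] have it
    because [u] is of class C^7 ([diffO_qsum]).

    The order conditions of the Runge-Kutta method are checked inside this
    calculus ([diffO_rk4_increment]). No derivative of [F] has to be computed: the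
    stages are compared with the exact solution, the deviations of the slopes
    are additive up to higher order, and only a few weighted sums of values of
    [u] and [u'] remain, whose vanishing moments are elementary. If the error [e]
    is [m] times differenceable with order 4 then so is its increment with order
    5, and three rounds of this ([diffO_rk4_error]) give the differences above.

    All the constants must be uniform in [t]. This comes from the compactness of
    the curve [t |-> (t, u t)] ([bounded_near_curve]), which bounds the
    derivatives of [F] up to order 6 on a tube around it; outside of the tube the
    Lipschitz condition replaces these bounds ([vector_field_taylor]). *)

(** * Identities between linear combinations *)

(** Identities in a module are proved by reflection: both sides are
    reified as formal linear combinations of a common list of atoms, and the
    tactic [lmod K] leaves one equation between scalars per atom, which [ring]
    or [field] can solve. *)
Inductive lexp (K : Type) :=
| LVar of nat | LZero | LAdd of lexp K & lexp K | LOpp of lexp K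
| LScale of K & lexp K.
Arguments LVar {K}.
Arguments LZero {K}.

Section LinearNormalisation.
Variables (K : nzRingType) (V : lmodType K).

Fixpoint leval (env : seq V) (e : lexp K) : V :=
  match e with
  | LVar n => env`_n
  | LZero => 0
  | LAdd e1 e2 => leval env e1 + leval env e2
  | LOpp e1 => - leval env e1
  | LScale c e1 => c *: leval env e1
  end.

Fixpoint lcoef (e : lexp K) (n : nat) : K :=
  match e with
  | LVar m => if Nat.eqb m n then 1 else 0
  | LZero => 0
  | LAdd e1 e2 => lcoef e1 n + lcoef e2 n
  | LOpp e1 => - lcoef e1 n
  | LScale c e1 => c * lcoef e1 n
  end.

Fixpoint lcoefs_agree (e1 e2 : lexp K) (n : nat) : Prop :=
  if n is n'.+1 then lcoef e1 n' = lcoef e2 n' /\ lcoefs_agree e1 e2 n'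
  else True.

Lemma leval_lcoef env e :
  leval env e = \sum_(n < size env) lcoef e n *: env`_n.
Proof.
elim: e => [m||e1 IH1 e2 IH2|e1 IH1|c e1 IH1] /=.
- have [lt_m|le_m] := ltnP m (size env).
    rewrite (bigD1 (Ordinal lt_m)) //= PeanoNat.Nat.eqb_refl scale1r big1 ?addr0 //.
    move=> i; case: ifP => [/PeanoNat.Nat.eqb_eq m_i|_ _]; last by rewrite scale0r.
    by case/eqP; apply: val_inj; rewrite /= m_i.
  rewrite nth_default // big1 // => i _; case: ifP => [/PeanoNat.Nat.eqb_eq m_i|_].
    by have := ltn_ord i; rewrite -m_i ltnNge le_m.
  by rewrite scale0r.
- by rewrite big1 // => i _; rewrite scale0r.
- by rewrite IH1 IH2 -big_split; apply: eq_bigr => i _; rewrite scalerDl.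
- by rewrite IH1 -sumrN; apply: eq_bigr => i _; rewrite scaleNr.
- by rewrite IH1 scaler_sumr; apply: eq_bigr => i _; rewrite scalerA.
Qed.

Lemma leval_eq env e1 e2 :
  lcoefs_agree e1 e2 (size env) -> leval env e1 = leval env e2.
Proof.
move=> agree; rewrite !leval_lcoef; apply: eq_bigr => -[i /= lt_i] _.
congr (_ *: _); elim: (size env) agree lt_i => //= n IH [en /IH {}IH].
by rewrite ltnS leq_eqVlt => /orP[/eqP->|/IH].
Qed.

End LinearNormalisation.

Ltac lmod_insert x env :=
  match env with
  | @nil _ => constr:([:: x])
  | x :: _ => env
  | ?y :: ?s => let s' := lmod_insert x s in constr:(y :: s')
  end.
Ltac lmod_atoms e env :=
  match e with
  | 0%R => env
  | (?a + ?b)%R => let env' := lmod_atoms a env in lmod_atoms b env'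
  | (- ?a)%R => lmod_atoms a env
  | (_ *: ?a)%R => lmod_atoms a env
  | _ => lmod_insert e env
  end.
Ltac lmod_index x env :=
  match env with
  | x :: _ => constr:(0%N)
  | _ :: ?s => let n := lmod_index x s in constr:(S n)
  end.
Ltac lmod_reify K e env :=
  match e with
  | 0%R => constr:(@LZero K)
  | (?a + ?b)%R => let a' := lmod_reify K a env in
                   let b' := lmod_reify K b env in constr:(@LAdd K a' b')
  | (- ?a)%R => let a' := lmod_reify K a env in constr:(@LOpp K a')
  | (?c *: ?a)%R => let a' := lmod_reify K a env in constr:(@LScale K c a')
  | _ => let n := lmod_index e env in constr:(@LVar K n)
  end.
Ltac lmod K :=
  match goal with |- @eq ?V ?x ?y =>
    let env0 := lmod_atoms x (@nil V) in
    let env := lmod_atoms y env0 in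
    let ex := lmod_reify K x env in
    let ey := lmod_reify K y env in
    apply: (@leval_eq _ _ env ex ey);
    cbv beta iota zeta delta [lcoefs_agree lcoef Nat.eqb size];
    repeat split
  end.

(** * Mean value inequality and Taylor's formula on a segment *)

(** [f'] is the derivative of [f] relative to [[a, b]], one-sided at the end
    points as in [class_C]; values of [f] outside of the segment do not enter. *)
Definition deriv_on (R : realType) (X : normedModType R) (a b : R)
    (f f' : R -> X) : Prop :=
  forall x, a <= x <= b -> forall eps : R, 0 < eps ->
    exists2 d : R, 0 < d & forall y, a <= y <= b -> `|y - x| < d ->
      `|f y - f x - (y - x) *: f' x| <= eps * `|y - x|.

Section Taylor.
Variables (R : realType) (X : normedModType R).
Implicit Types (f g : R -> X) (a b : R).

Lemma deriv_on_sub a b c d f f' : a <= c -> d <= b ->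
  deriv_on a b f f' -> deriv_on c d f f'.
Proof.
move=> ac db df x /andP[cx xd] e e0.
have [|r r0 Hr] := df x _ e e0; first by apply/andP; split; lra.
by exists r => // y /andP[cy yd] yx; apply: Hr => //; apply/andP; split; lra.
Qed.

Lemma deriv_onB a b f f' g g' : deriv_on a b f f' -> deriv_on a b g g' ->
  deriv_on a b (fun x => f x - g x) (fun x => f' x - g' x).
Proof.
move=> df dg x xab e e0; have e20 : 0 < e / 2 by lra.
have [r r0 Hr] := df x xab _ e20; have [s s0 Hs] := dg x xab _ e20.
exists (Num.min r s) => [|y yab]; first by rewrite lt_min r0.
rewrite lt_min => /andP[/(Hr _ yab) Hf /(Hs _ yab) Hg].
rewrite (_ : _ - _ = (f y - f x - (y - x) *: f' x) -
  (g y - g x - (y - x) *: g' x)); last by lmod R; ring.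
by apply: le_trans (ler_normB _ _) _; rewrite [e]splitr mulrDl lerD.
Qed.

(** A slope strictly larger than the bound on the derivative gives room to
    absorb the first order remainder. The supremum of the points of the segment
    at which the inequality holds satisfies the inequality too, and differentiability
    there would propagate it further to the right if it were not [b]. *)
Lemma mean_value_le_slack a b c M f f' : a <= b -> M < c ->
  deriv_on a b f f' -> (forall x, a <= x <= b -> `|f' x| <= M) ->
  `|f b - f a| <= c * (b - a).
Proof.
move=> ab Mc df bf.
have near x : a <= x <= b -> exists2 d : R, 0 < d & forall y,
    a <= y <= b -> `|y - x| < d -> `|f y - f x| <= c * `|y - x|.
  move=> xab; have [|d d0 Hd] := df x xab (c - M); first by lra.
  exists d => // y yab /(Hd _ yab) Hy.
  rewrite -[f y - f x](subrK ((y - x) *: f' x)).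
  apply: le_trans (ler_normD _ _) _; rewrite normrZ.
  have := ler_wpM2l (normr_ge0 (y - x)) (bf x xab); nra.
pose S := [set x | a <= x <= b /\ `|f x - f a| <= c * (x - a)].
have Sa : S a by split; rewrite ?lexx ?ab // !subrr normr0 mulr0.
have Sub : has_ubound S by exists b => x [/andP[]].
have supS : has_sup S by split; [exists a|].
have as_ : a <= sup S by apply: ub_le_sup.
have sb : sup S <= b by apply: ge_sup; [exists a|move=> x [/andP[]]].
have [d d0 Hd] : exists2 d : R, 0 < d & forall y,
    a <= y <= b -> `|y - sup S| < d -> `|f y - f (sup S)| <= c * `|y - sup S|.
  by apply: near; rewrite as_.
have Ss : S (sup S).
  split; first by rewrite as_.
  have [x [xab Sx] sx] := sup_adherent d0 supS.
  have xs : x <= sup S by apply: ub_le_sup.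
  have := Hd x xab; rewrite ler0_norm ?subr_le0 // opprB distrC => Hx.
  rewrite (_ : _ - f a = (f (sup S) - f x) + (f x - f a)); last by lmod R; ring.
  apply: le_trans (ler_normD _ _) _.
  have {Hx} : `|f (sup S) - f x| <= c * (sup S - x) by apply: Hx; lra.
  by move: Sx; lra.
suff bs : b <= sup S.
  have {}bs : b = sup S by apply/eqP; rewrite eq_le bs sb.
  by have [_] := Ss; rewrite -bs.
rewrite leNgt; apply/negP => sltb.
pose y := Num.min b (sup S + d / 2).
have sy : sup S < y by rewrite lt_min sltb; lra.
have yb : y <= b by rewrite ge_min lexx.
have yd : y <= sup S + d / 2 by rewrite ge_min lexx orbT.
have Sy : S y.
  split; first by apply/andP; split=> //; lra.
  have [_ Hs] := Ss.
  have := Hd y; rewrite gtr0_norm ?subr_gt0 // => Hy.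
  have {Hy} : `|f y - f (sup S)| <= c * (y - sup S).
    by apply: Hy; [apply/andP; split=> //; lra|lra].
  rewrite (_ : _ - f a = (f y - f (sup S)) + (f (sup S) - f a)); last first.
    by lmod R; ring.
  by move=> Hy; apply: le_trans (ler_normD _ _) _; lra.
by have := ub_le_sup Sub Sy; rewrite leNgt sy.
Qed.

Lemma mean_value_le a b M f f' : a <= b ->
  deriv_on a b f f' -> (forall x, a <= x <= b -> `|f' x| <= M) ->
  `|f b - f a| <= M * (b - a).
Proof.
move=> ab df bf; apply/ler_addgt0Pr => e e0.
have d0 : 0 < e / (b - a + 1) by rewrite divr_gt0 //; lra.
have := @mean_value_le_slack a b (M + e / (b - a + 1)) M f f' ab _ df bf.
move=> /(_ _)/le_trans; apply; first by lra.
rewrite mulrDl lerD2l mulrAC ler_pdivrMr; last by lra.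
by rewrite ler_wpM2l //; lra.
Qed.

(** By induction on the degree: each normalised monomial is [(x - a) / (j + 2)]
    times the preceding one, and the Leibniz rule is proved for the factor
    [x - a]. *)
Lemma deriv_on_monomial a b j (v : X) :
  deriv_on a b (fun x => ((x - a) ^+ j.+1 / j.+1`!%:R) *: v)
               (fun x => ((x - a) ^+ j / j`!%:R) *: v).
Proof.
have step g g' : deriv_on a b g g' ->
    deriv_on a b (fun x => (x - a) *: g x) (fun x => g x + (x - a) *: g' x).
  move=> dg x xab e e0.
  have ba : 0 <= b - a by move: xab => /andP[]; lra.
  pose D := `|g' x| + 1; have D0 : 0 < D by rewrite ltr_wpDl.
  have e1 : 0 < e / 2 / (b - a + 1) by rewrite divr_gt0 //; lra.
  have [r r0 Hr] := dg x xab _ e1.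
  exists (Num.min r (e / 2 / D)) => [|y yab].
    by rewrite lt_min r0 divr_gt0 //; lra.
  rewrite lt_min => /andP[/(Hr _ yab) Hg yx].
  rewrite (_ : _ - _ = (y - a) *: (g y - g x - (y - x) *: g' x) +
    ((y - x) * (y - x)) *: g' x); last by lmod R; ring.
  apply: le_trans (ler_normD _ _) _; rewrite !normrZ. rewrite [e]splitr mulrDl.
  apply: lerD.
    have ya : `|y - a| <= b - a + 1.
      by move: yab => /andP[ay yb]; rewrite ger0_norm; lra.
    apply: le_trans (ler_pM _ _ ya Hg) _ => //.
    by rewrite mulrA [_ * (_ / _)]mulrC divfK //; lra.
  rewrite mulrAC ler_wpM2r //.
  have : `|y - x| * D <= e / 2 by rewrite -ler_pdivlMr // ltW.
  by apply: le_trans; rewrite ler_wpM2l // lerDl.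
elim: j => [|j IH].
  move=> x xab e e0; exists 1 => // y _ _.
  rewrite (_ : _ - _ = 0); first by rewrite normr0 mulr_ge0 // ltW.
  by rewrite expr0 !expr1; lmod R; field.
move=> x xab e e0.
have f0 : (j`!%:R : R) != 0 by rewrite pnatr_eq0 -lt0n fact_gt0.
have e1 : 0 < e * j.+2%:R by rewrite mulr_gt0.
have [d d0 Hd] := step _ _ IH x xab _ e1.
exists d => // y yab /(Hd y yab) {}Hd.
rewrite -(ler_pM2l (_ : 0 < j.+2%:R :> R)) ?ltr0n //.
rewrite -[X in X * `|_|]ger0_norm ?ler0n // -normrZ.
rewrite mulrA [_ * e]mulrC; apply: le_trans Hd.
rewrite le_eqVlt; apply/orP; left; apply/eqP; congr (`|_|).
rewrite !factS !natrM -!natr1 !exprS; lmod R; field.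
by rewrite f0 !natr1 !pnatr_eq0.
Qed.

(** [f j] stands for the [j]-th derivative. The induction applies the formula
    to the derivative of [f 0], and the mean value inequality integrates it; the
    factor [1 / n!] of the sharp remainder is given up, as only orders matter. *)
Lemma taylor_le n (f : nat -> R -> X) a b M : a <= b ->
  (forall j, (j < n)%N -> deriv_on a b (f j) (f j.+1)) ->
  (forall x, a <= x <= b -> `|f n x| <= M) ->
  `|f 0%N b - \sum_(j < n) ((b - a) ^+ j / j`!%:R) *: f j a| <= M * (b - a) ^+ n.
Proof.
elim: n f b => [|n IH] f b ab df bf.
  by rewrite big_ord0 subr0 expr0 mulr1 bf // ab lexx.
pose P (x : R) : X := \sum_(j < n) ((x - a) ^+ j / j`!%:R) *: f j.+1 a.
pose Q m (x : R) : X := \sum_(j < m) ((x - a) ^+ j.+1 / j.+1`!%:R) *: f j.+1 a.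
pose Q' m (x : R) : X := \sum_(j < m) ((x - a) ^+ j / j`!%:R) *: f j.+1 a.
have dQ m : deriv_on a b (Q m) (Q' m).
  elim: m => [|m IHm] x xab e e0.
    exists 1 => // y _ _; rewrite /Q /Q' !big_ord0 !subrr add0r scaler0 oppr0.
    by rewrite normr0 mulr_ge0 // ltW.
  have e20 : 0 < e / 2 by lra.
  have [r r0 Hr] := IHm x xab _ e20.
  have [s s0 Hs] := deriv_on_monomial (b := b) m (f m.+1 a) xab e20.
  exists (Num.min r s) => [|y yab]; first by rewrite lt_min r0.
  rewrite lt_min => /andP[/(Hr _ yab) Hf /(Hs _ yab) Hg].
  rewrite (_ : _ - _ = (Q m y - Q m x - (y - x) *: Q' m x) +
      (((y - a) ^+ m.+1 / m.+1`!%:R) *: f m.+1 a -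
       ((x - a) ^+ m.+1 / m.+1`!%:R) *: f m.+1 a -
       (y - x) *: (((x - a) ^+ m / m`!%:R) *: f m.+1 a))); last first.
    rewrite [Q m.+1 y]big_ord_recr [Q m.+1 x]big_ord_recr.
    rewrite [Q' m.+1 x]big_ord_recr /= -/(Q m y) -/(Q m x) -/(Q' m x).
    by lmod R; ring.
  by rewrite [e]splitr mulrDl; apply: le_trans (ler_normD _ _) (lerD Hf Hg).
have ran : forall x, a <= x <= b -> `|f 1%N x - P x| <= M * (x - a) ^+ n.
  move=> x /andP[ax xb]; apply: (IH (fun j => f j.+1)) => // [j jn|y /andP[ay yx]].
    exact: deriv_on_sub (df _ _).
  by apply: bf; rewrite ay; lra.
have M0 : 0 <= M by apply: le_trans (bf a _); rewrite ?lexx.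
have := @mean_value_le a b (M * (b - a) ^+ n) _ _ ab
  (deriv_onB (df 0%N isT) (dQ n)).
rewrite -mulrA -exprSr => mv; apply: le_trans (mv _); last first.
  move=> x xab; apply: le_trans (ran x xab) _; rewrite ler_wpM2l //.
  by move: xab => /andP[ax xb]; rewrite lerXn2r ?nnegrE; lra.
rewrite big_ord_recl /= expr0 divr1 scale1r /Q subrr.
rewrite [X in _ - (f 0%N a - X)]big1 ?subr0; last first.
  by move=> i _; rewrite exprS !mul0r scale0r.
rewrite le_eqVlt; apply/orP; left; apply/eqP; congr (`|_|).
by rewrite opprD addrCA [RHS]addrC addrA.
Qed.

End Taylor.

(** * Iterated Frechet derivatives along lines and curves *)

Section Multilinear.
Variables (R : realType) (E G : normedModType R) (j : nat).
Variable A : ('I_j -> E) -> G.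
Hypothesis mA : multilinear_map A.

Lemma multilinear0 (h : 'I_j -> E) i : A [eta h with i |-> 0] = 0.
Proof.
have := mA h i 1 0 0; rewrite !scale1r addr0 => A0.
by apply: (@addrI _ (A [eta h with i |-> 0])); rewrite -A0 addr0.
Qed.

Lemma multilinearZ (h : 'I_j -> E) i a x :
  A [eta h with i |-> a *: x] = a *: A [eta h with i |-> x].
Proof. by have := mA h i a x 0; rewrite multilinear0 !addr0. Qed.

Lemma multilinearB (h : 'I_j -> E) i x y :
  A [eta h with i |-> x - y] = A [eta h with i |-> x] - A [eta h with i |-> y].
Proof.
by have := mA h i (-1) y x; rewrite !scaleN1r addrC => ->; rewrite addrC.
Qed.

End Multilinear.

Lemma opnorm_leW (R : realType) (E G : normedModType R) j (M N : R)
    (A : ('I_j -> E) -> G) : M <= N -> opnorm_le M A -> opnorm_le N A.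
Proof.
by move=> MN AM h; apply: le_trans (AM h) _; rewrite ler_wpM2r // prodr_ge0.
Qed.

Section Differentiability.
Variables (R : realType) (E G : normedModType R) (m : nat) (D : set E).
Variable Df : forall j : nat, E -> ('I_j -> E) -> G.
Arguments Df : clear implicits.
Hypothesis mulDf : forall j x, (j <= m)%N -> D x ->
  multilinear_map (Df j x) /\ exists M : R, opnorm_le M (Df j x).
Hypothesis derDf : forall j x, (j < m)%N -> D x -> forall eps : R, 0 < eps ->
  \forall y \near within D (nbhs x),
    opnorm_le (eps * `|y - x|)
      (fun h => Df j y h - Df j x h - Df j.+1 x (cons_arg (y - x) h)).
Hypothesis cntDf : forall x, D x -> forall eps : R, 0 < eps ->
  \forall y \near within D (nbhs x),
    opnorm_le eps (fun h => Df m y h - Df m x h).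

Lemma near_withinP (x : E) (P : E -> Prop) :
  (\forall y \near within D (nbhs x), P y) ->
  exists2 d : R, 0 < d & forall y, D y -> `|y - x| < d -> P y.
Proof.
move=> /nbhs_normP[d d0 Hd]; exists d => // y Dy yx.
by apply: Hd => //=; rewrite distrC.
Qed.

(** Along a line all the increments point in the direction [z], and
    [cons_arg (r *: z) (fun=> z)] is [fun=> z] up to the scalar [r]: the iterated
    Frechet derivatives become an ordinary sequence of derivatives in one
    variable. *)
Lemma deriv_on_line (p z : E) a b j : (j < m)%N ->
  (forall s, a <= s <= b -> D (p + s *: z)) ->
  deriv_on a b (fun s => Df j (p + s *: z) (fun=> z))
               (fun s => Df j.+1 (p + s *: z) (fun=> z)).
Proof.
move=> jm Dl x xab e e0.
have z0 : 0 < `|z| ^+ j.+1 + 1 by rewrite ltr_wpDl // exprn_ge0.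
have e1 : 0 < e / (`|z| ^+ j.+1 + 1) by rewrite divr_gt0.
have [d d0 Hd] := near_withinP (derDf jm (Dl x xab) e1).
have z1 : 0 < `|z| + 1 by rewrite ltr_wpDl.
exists (d / (`|z| + 1)) => [|y yab yx]; first by rewrite divr_gt0.
have pq : p + y *: z - (p + x *: z) = (y - x) *: z by lmod R; ring.
have := Hd _ (Dl y yab); rewrite pq normrZ => Hy.
have zd : `|y - x| * `|z| < d.
  move: yx; rewrite ltr_pdivlMr //; apply: le_lt_trans.
  by rewrite ler_wpM2l // lerDl.
have {Hy} := Hy zd (fun=> z); rewrite (_ : cons_arg _ _ =
    [eta (fun=> z) with ord0 |-> (y - x) *: z]); last first.
  apply/funext => i; rewrite /cons_arg /=; by case: unliftP => [k ->|->].
have [mul _] := mulDf jm (Dl x xab).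
rewrite multilinearZ //.
rewrite (_ : ([eta (fun=> z) with ord0 |-> z] : 'I_j.+1 -> E) = fun=> z); last first.
  by apply/funext => i /=; case: ifP.
move=> /le_trans; apply; rewrite prodr_const card_ord.
rewrite (_ : _ * _ = e * `|y - x| * ((`|z| ^+ j.+1 + 1)^-1 * `|z| ^+ j.+1)).
  by rewrite ler_piMr ?mulr_ge0 ?(ltW e0) // ler_pdivrMl // mulr1 lerDl.
by rewrite exprS; ring.
Qed.

Lemma bounded_near j x : (j <= m)%N -> D x -> exists M : R,
  \forall y \near within D (nbhs x), opnorm_le M (Df j y).
Proof.
move=> jm Dx; have [_ [M HM]] := mulDf jm Dx.
move: jm; rewrite leq_eqVlt => /predU1P[j_m|jm]; last first.
  have [_ [N HN]] := mulDf jm Dx.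
  exists (M + 1 + `|N|); have [d d0 Hd] := near_withinP (derDf jm Dx ltr01).
  apply/nbhs_normP; exists (Num.min d 1) => /=; first by rewrite lt_min d0 /=.
  move=> y; rewrite /= lt_min distrC => /andP[yd y1] Dy h.
  have := Hd y Dy yd h; rewrite mul1r => Hy.
  rewrite -[Df j y h](subrK (Df j x h)).
  rewrite -[X in `|X + _|](subrK (Df j.+1 x (cons_arg (y - x) h))).
  set p := \prod_(i < j) `|h i| in Hy *.
  have p0 : 0 <= p by rewrite prodr_ge0.
  rewrite (_ : (M + 1 + `|N|) * p = p + `|N| * p + M * p); last by ring.
  apply: le_trans (ler_normD _ _) _; apply: lerD (HM h).
  apply: le_trans (ler_normD _ _) _; apply: lerD.
    by apply: le_trans Hy _; rewrite ler_piMl // ltW.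
  apply: le_trans (HN _) _; rewrite big_ord_recl /cons_arg unlift_none.
  under eq_bigr do rewrite liftK.
  rewrite mulrA ler_wpM2r //; apply: le_trans (ler_norm _) _.
  by rewrite normrM normr_id ler_piMr // ltW.
subst j; exists (M + 1); have [d d0 Hd] := near_withinP (cntDf Dx ltr01).
apply/nbhs_normP; exists d => //= y /=; rewrite distrC => yd Dy h.
rewrite -[Df m y h](subrK (Df m x h)) addrC.
by rewrite mulrDl; apply: le_trans (ler_normD _ _) _; rewrite lerD // Hd.
Qed.

(** One number [d] serves as radius and, through [d^-1], as bound, so that
    the property gets weaker when [d] decreases and compactness applies to it as
    it stands. *)
Lemma bounded_near_all x : D x -> exists2 d : R, 0 < d &
  forall y, D y -> `|y - x| < d ->
  forall j, (j <= m)%N -> opnorm_le d^-1 (Df j y).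
Proof.
move=> Dx; suff H n : (n <= m)%N -> exists2 d : R, 0 < d &
    forall y, D y -> `|y - x| < d ->
    forall j, (j <= n)%N -> opnorm_le d^-1 (Df j y) by exact: H.
have one j : (j <= m)%N -> exists2 d : R, 0 < d &
    forall y, D y -> `|y - x| < d -> opnorm_le d^-1 (Df j y).
  move=> jm; have [M /near_withinP[d d0 Hd]] := bounded_near jm Dx.
  have M1 : 0 < `|M| + 1 by rewrite ltr_wpDl.
  exists (Num.min d (`|M| + 1)^-1); first by rewrite lt_min d0 invr_gt0.
  move=> y Dy; rewrite lt_min => /andP[yd _].
  apply: opnorm_leW (Hd y Dy yd); apply: (le_trans (ler_norm _)).
  apply: (@le_trans _ _ (`|M| + 1)); first by rewrite lerDl.
  rewrite -[leLHS]invrK lef_pV2 ?posrE ?invr_gt0 ?lt_min ?invr_gt0 ?d0 //.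
  by rewrite ge_min lexx orbT.
elim: n => [m0|n IH nm].
  have [d d0 Hd] := one 0%N m0; exists d => // y Dy yd j.
  by rewrite leqn0 => /eqP->; exact: Hd.
have [d d0 Hd] := one n.+1 nm; have [r r0 Hr] := IH (ltnW nm).
exists (Num.min d r); first by rewrite lt_min d0.
move=> y Dy; rewrite lt_min => /andP[yd yr] j.
rewrite leq_eqVlt => /predU1P[->|jn].
  apply: opnorm_leW (Hd y Dy yd).
  by rewrite lef_pV2 ?posrE ?lt_min ?d0 // ge_min lexx.
apply: opnorm_leW (Hr y Dy yr j jn).
by rewrite lef_pV2 ?posrE ?lt_min ?d0 // ge_min lexx orbT.
Qed.

(** In infinite dimension bounded sets are not compact, but the curve is: all
    the constants owe their uniformity in time to this lemma. *)
Lemma bounded_near_curve (a b : R) (c : R -> E) :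
  (forall t, a <= t <= b -> D (c t)) ->
  (forall t, a <= t <= b -> forall e : R, 0 < e -> exists2 d : R, 0 < d &
     forall s, a <= s <= b -> `|s - t| < d -> `|c s - c t| < e) ->
  exists2 d : R, 0 < d & forall t y, a <= t <= b -> D y -> `|y - c t| < d ->
    forall j, (j <= m)%N -> opnorm_le d^-1 (Df j y).
Proof.
move=> Dc cc.
pose P (d t : R) := forall y, D y -> `|y - c t| < d ->
  forall j, (j <= m)%N -> opnorm_le d^-1 (Df j y).
have cov : near_covering_within `[a, b].
  by apply/near_covering_withinP/compact_near_coveringP/segment_compact.
have : \forall d \near 0^'+, `[a, b] `<=` P d.
  apply: cov => t /=; rewrite in_itv /= => tab.
  have [d d0 Hd] := bounded_near_all (Dc t tab).
  have d20 : 0 < d / 2 by lra.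
  have [r r0 Hr] := cc t tab _ d20.
  near=> s e => /=; rewrite in_itv /= => sab y Dy ys j jm.
  have e0 : 0 < e by near: e; exact: nbhs_right_gt.
  have ed : e < d / 2 by near: e; exact: nbhs_right_lt.
  apply: opnorm_leW (Hd y Dy _ j jm).
    by rewrite lef_pV2 ?posrE //; lra.
  have st : `|s - t| < r.
    by near: s; apply/nbhs_normP; exists r => //= s /=; rewrite distrC.
  rewrite -[y](subrK (c s)) -addrA; apply: le_lt_trans (ler_normD _ _) _.
  by have := Hr s sab st; lra.
move=> H; near ((0 : R)^'+) => d; exists d.
  by near: d; exact: nbhs_right_gt.
move=> t y tab Dy ys j; have : `[a, b] `<=` P d by near: d.
by move=> /(_ t) Pdt; apply: Pdt ys j => //; rewrite /= in_itv.
Unshelve. all: by end_near. Qed.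

End Differentiability.

(** * Taylor's formula at the points of a curve *)

Section Taylor.
Variables (R : realType) (X : normedModType R).

(** The successive derivatives of a curve on [[a, b]] up to order [n], with a
    common bound. *)
Definition jet (n : nat) (a b M : R) (U : nat -> R -> X) : Prop :=
  (forall j, (j < n)%N -> deriv_on a b (U j) (U j.+1)) /\
  (forall j t, (j <= n)%N -> a <= t <= b -> `|U j t| <= M).

Lemma class_C_jet n (a b : R) (f : R -> X) : class_C n [set` `[a, b]] f ->
  exists U M, (forall t, a <= t <= b -> U 0%N t = f t) /\ jet n a b M U.
Proof.
case=> Df [Df0 mulDf derDf cntDf].
have D t : a <= t <= b -> [set` `[a, b]] t by rewrite /= in_itv.
exists (fun j t => Df j t (fun=> 1)).
have [|t tab e e0|d d0 Hd] :=
  bounded_near_curve mulDf derDf cntDf (c := id) (a := a) (b := b).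
- by move=> t; apply: D.
- by exists e.
exists d^-1; split; [|split].
- by move=> t /D/Df0.
- move=> j jn.
  have line s : a <= s <= b -> [set` `[a, b]] (0 + s *: (1 : R)).
    by rewrite add0r /GRing.scale /= mulr1; apply: D.
  have eqs (s : R) : 0 + s *: (1 : R) = s by rewrite add0r /GRing.scale /= mulr1.
  have := deriv_on_line mulDf derDf jn line.
  by under eq_fun do rewrite eqs; under [X in deriv_on _ _ _ X]eq_fun do rewrite eqs.
- move=> j t jn tab.
  apply: le_trans (Hd t t tab (D t tab) _ j jn _) _; first by rewrite subrr normr0.
  by rewrite prodr_const normr1 expr1n mulr1.
Qed.

Section Jet.
Variables (n : nat) (a b M : R) (U : nat -> R -> X).
Hypothesis jU : jet n a b M U.

Lemma jet_taylor j m s t : (j + m <= n)%N -> a <= s -> s <= t -> t <= b ->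
  `|U j t - \sum_(l < m) ((t - s) ^+ l / l`!%:R) *: U (j + l)%N s|
    <= M * (t - s) ^+ m.
Proof.
move=> jm as_ st tb; case: jU => dU bU.
have := @taylor_le R X m (fun l => U (j + l)%N) s t M st; rewrite addn0; apply.
  move=> l lm; rewrite addnS; apply: deriv_on_sub (dU _ _) => //.
  by apply: leq_trans jm; rewrite -addnS leq_add2l.
move=> x /andP[sx xt]; apply: bU; first by [].
by rewrite (le_trans as_ sx) (le_trans xt tb).
Qed.

Lemma jet_lipschitz s t : (0 < n)%N -> a <= s <= b -> a <= t <= b ->
  `|U 0%N t - U 0%N s| <= M * `|t - s|.
Proof.
move=> n0; wlog st : s t / s <= t.
  move=> H sab tab; have [/H|/ltW/H] := leP s t; last rewrite distrC [X in _ * X]distrC;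
    exact.
move=> /andP[as_ _] /andP[_ tb].
have := @jet_taylor 0%N 1%N s t n0 as_ st tb.
by rewrite big_ord1 expr0 divr1 scale1r expr1 ger0_norm ?subr_ge0.
Qed.

End Jet.

(** Both the first derivative of the jet and [F (t, u t)] are limits of the
    difference quotient at [t]; as [T > 0] there are points [s != t] of [[0, T]]
    arbitrarily close to [t]. *)
Lemma jet_ode n T M U (F : R * X -> X) u0 u : 0 < T -> (0 < n)%N ->
  jet n 0 T M U -> (forall t, 0 <= t <= T -> U 0%N t = u t) ->
  cauchy_solution T F u0 u -> forall t, 0 <= t <= T -> U 1%N t = F (t, u t).
Proof.
move=> T0 n0 [dU _] U0 [_ du] t tT.
have /du/cvgrPdist_lt dut : t \in `[0, T] by rewrite in_itv.
apply/eqP; rewrite -subr_eq0 -normr_le0; apply/ler_addgt0Pr => e e0.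
have e20 : 0 < e / 2 by lra.
have [d d0 Hd] := dU _ n0 t tT _ e20.
have {dut} /(@nbhs_normP _ _ t)[r r0 Hr] := dut _ e20.
pose q := Num.min (Num.min d r) T / 2.
have m0 : 0 < Num.min (Num.min d r) T by rewrite !lt_min d0 r0.
have qd : q < d by rewrite ltr_pdivrMr // !gt_min ltr_pMr // ltr1n.
have qr : q < r by rewrite ltr_pdivrMr // !gt_min ltr_pMr // ltr1n orbT.
have qT : q <= T / 2 by rewrite ler_pM2r ?invr_gt0 // ge_min lexx orbT.
have q0 : 0 < q by rewrite divr_gt0.
have [s sT [st nst]] : exists2 s, 0 <= s <= T & `|s - t| = q /\ s != t.
  have [t2|t2] := leP t (T / 2).
    exists (t + q); first by apply/andP; split; lra.
    rewrite addrAC subrr add0r gtr0_norm //; split=> //.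
    by rewrite gt_eqF // ltrDl.
  exists (t - q); first by apply/andP; split; lra.
  rewrite addrAC subrr add0r normrN gtr0_norm //; split=> //.
  by rewrite lt_eqF // gtrBl.
have H1 : `|F (t, u t) - (s - t)^-1 *: (u s - u t)| < e / 2.
  by apply: Hr => //=; rewrite ?in_itv //= distrC st.
have H2 := Hd s sT; rewrite st !U0 // in H2.
have {}H2 := H2 qd.
have st0 : s - t != 0 by rewrite subr_eq0.
rewrite (_ : _ - _ = ((s - t)^-1 *: (u s - u t) - F (t, u t)) -
    (s - t)^-1 *: (u s - u t - (s - t) *: U 1%N t)); last by lmod R; field.
apply: le_trans (ler_normB _ _) _; rewrite add0r [e]splitr; apply: lerD.
  by rewrite distrC ltW.
by rewrite normrZ normfV st ler_pdivrMl // mulrC.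
Qed.

(** Convexity of [D] keeps the segment from [c t] to [c t + z] inside the
    domain, where the formula in one variable applies; the radius and the constant
    are those of [bounded_near_curve], hence the same for all [t]. *)
Lemma class_C_taylor (E G : normedModType R) n (D : set E) (f : E -> G)
    (a b : R) (c : R -> E) L :
  class_C n D f ->
  (forall p q s, D p -> D q -> 0 <= s <= 1 -> D (p + s *: (q - p))) ->
  (forall t, a <= t <= b -> D (c t)) ->
  (forall s t, a <= s <= b -> a <= t <= b -> `|c t - c s| <= L * `|t - s|) ->
  exists (A : forall j : nat, E -> ('I_j -> E) -> G) (d : R),
  [/\ 0 < d,
      forall j t, (j <= n)%N -> a <= t <= b ->
        multilinear_map (A j (c t)) /\ opnorm_le d^-1 (A j (c t))
    & forall t z, a <= t <= b -> D (c t + z) -> `|z| < d ->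
      `|f (c t + z) - \sum_(j < n) j`!%:R^-1 *: A j (c t) (fun=> z)|
        <= d^-1 * `|z| ^+ n].
Proof.
case=> Df [Df0 mulDf derDf cntDf] cvxD Dc lipc.
have [//||d d0 Hd] :=
  bounded_near_curve mulDf derDf cntDf (c := c) (a := a) (b := b).
  move=> t tab e e0; have L1 : 0 < `|L| + 1 by rewrite ltr_wpDl.
  exists (e / (`|L| + 1)) => [|s sab st]; first by rewrite divr_gt0.
  apply: le_lt_trans (lipc t s tab sab) _.
  move: st; rewrite ltr_pdivlMr // mulrC; apply: le_lt_trans.
  by rewrite ler_wpM2r // (le_trans (ler_norm _)) // lerDl.
exists Df, d; split=> // [j t jn tab|t z tab Dz zd].
  split; first by have [] := mulDf j (c t) jn (Dc t tab).
  by apply: (Hd t (c t) tab (Dc t tab)) => //; rewrite subrr normr0.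
have line s : 0 <= s <= 1 -> D (c t + s *: z).
  move=> s01; have := cvxD _ _ s (Dc t tab) Dz s01.
  by rewrite [c t + z]addrC addrK.
have := @taylor_le R G n (fun j s => Df j (c t + s *: z) (fun=> z)) 0 1
  (d^-1 * `|z| ^+ n) ler01.
rewrite subr0 expr1n mulr1 scale1r scale0r addr0 Df0 //.
under [in X in _ -> _ -> X]eq_bigr do rewrite expr1n div1r.
apply=> [j jn|s s01]; first exact: (deriv_on_line mulDf derDf).
apply: le_trans (Hd t _ tab (line s s01) _ n (leqnn n) _) _.
  rewrite addrAC subrr add0r normrZ; apply: le_lt_trans zd.
  by move: s01 => /andP[s0 s1]; rewrite ger0_norm // ler_piMl.
by rewrite prodr_const card_ord.
Qed.

End Taylor.

(** * Sequences whose differences gain powers of the step *)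

(** The argument of the [l]-th term in the telescoping of [A y - A x]: slots
    before [l] have already been moved to [y], slot [l] carries the difference. *)
Definition splice (T : Type) (j : nat) (y d x : 'I_j -> T) (l : nat)
    (k : 'I_j) : T :=
  if (k < l)%N then y k else if (k == l :> nat) then d k else x k.

Lemma multilinear_telescope (R : realType) (E G : normedModType R) (j : nat)
    (A : ('I_j -> E) -> G) (x y : 'I_j -> E) : multilinear_map A ->
  A y - A x = \sum_(l < j) A (splice y (fun k => y k - x k) x l).
Proof.
move=> mA; pose w (n : nat) (k : 'I_j) := if (k < n)%N then y k else x k.
have -> : A y = A (w j) by congr A; apply/funext => k; rewrite /w ltn_ord.
have -> : A x = A (w 0%N) by congr A; apply/funext.
rewrite -(telescope_sumr (A \o w) (leq0n j)) big_mkord; apply: eq_bigr => l _ /=.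
rewrite (_ : splice _ _ _ _ = [eta w l with l |-> y l - x l]).
  rewrite multilinearB //; congr (A _ - A _); apply/funext => k /=.
    rewrite /w ltnS leq_eqVlt -val_eqE; case: eqP => //= kl.
    by congr y; apply: val_inj.
  rewrite /w -val_eqE; case: eqP => //= kl; rewrite kl ltnn.
  by congr x; apply: val_inj.
apply/funext => k; rewrite /splice /w /= -val_eqE.
case: eqP => [kl|_] //; rewrite kl ltnn.
by have -> : k = l by apply: val_inj.
Qed.

Section DifferenceOrder.
Variables (R : realType) (I : Type) (h : I -> R).
Hypothesis h01 : forall e, 0 < h e <= 1.

(** The families are indexed by an abstract parameter [e : I] (later: a time
    and a substep) and by the rank [i < L] of a grid point; the constant may not
    depend on either of them. *)
Definition stepO (V : normedModType R) (L p : nat) (f : I -> nat -> V) : Prop :=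
  exists C : R, forall e i, (i < L)%N -> `|f e i| <= C * h e ^+ p.

(** Finite difference substitute for: [f e i = h^p g (t0 + i h)] with [g] of
    class C^m. Each difference in [i] gains one power of the step [h e], up to the
    [m]-th one, and shortens the grid by one point. *)
Fixpoint diffO (V : normedModType R) (m L p : nat) (f : I -> nat -> V) : Prop :=
  stepO L p f /\
  if m is m'.+1 then diffO m' L.-1 p.+1 (fun e i => f e i.+1 - f e i) else True.

Section OneSpace.
Variable V : normedModType R.
Implicit Types (f g : I -> nat -> V) (L m p q : nat).

Lemma stepO_ge0 L p f : stepO L p f -> exists2 C : R, 0 <= C &
  forall e i, (i < L)%N -> `|f e i| <= C * h e ^+ p.
Proof.
move=> [C HC]; exists `|C| => // e i iL; apply: le_trans (HC e i iL) _.
have /andP[h0 _] := h01 e.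
by rewrite ler_wpM2r ?ler_norm // exprn_ge0 // ltW.
Qed.

Lemma stepO_le L L' p q f : (L' <= L)%N -> (q <= p)%N -> stepO L p f -> stepO L' q f.
Proof.
move=> LL qp /stepO_ge0[C C0 HC]; exists C => e i iL; have /andP[h0 h1] := h01 e.
apply: le_trans (HC e i (leq_trans iL LL)) _; rewrite ler_wpM2l //.
by rewrite ler_wiXn2l // ltW.
Qed.

Lemma stepOD L p f g : stepO L p f -> stepO L p g ->
  stepO L p (fun e i => f e i + g e i).
Proof.
move=> [C HC] [C' HC']; exists (C + C') => e i iL; rewrite mulrDl.
by apply: le_trans (ler_normD _ _) _; apply: lerD; [apply: HC|apply: HC'].
Qed.

Lemma stepOZ L p (a : R) f : stepO L p f -> stepO L p (fun e i => a *: f e i).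
Proof.
move=> [C HC]; exists (`|a| * C) => e i iL.
by rewrite normrZ -mulrA ler_wpM2l // HC.
Qed.

Lemma diffO_eq m L p f g : (forall e i, (i < L)%N -> f e i = g e i) ->
  diffO m L p f -> diffO m L p g.
Proof.
elim: m L p f g => [|m IH] L p f g fg /= [[C HC] Df]; split=> //.
- by exists C => e i iL; rewrite -fg // HC.
- by exists C => e i iL; rewrite -fg // HC.
apply: IH Df => e i iL; rewrite !fg //; by move: iL; rewrite ltn_predRL // => /ltnW.
Qed.

Lemma diffO_stepO m L p f : diffO m L p f -> stepO L p f.
Proof. by case: m => [|m] []. Qed.

Lemma diffO_narrow m L L' p f : (L' <= L)%N -> diffO m L p f -> diffO m L' p f.
Proof.
elim: m L L' p f => [|m IH] L L' p f LL /= [Bf Df]; split=> //.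
- exact: stepO_le Bf.
- exact: stepO_le Bf.
by apply: IH Df; rewrite -!subn1 leq_sub2r.
Qed.

Lemma diffOD m L p f g : diffO m L p f -> diffO m L p g ->
  diffO m L p (fun e i => f e i + g e i).
Proof.
elim: m L p f g => [|m IH] L p f g /= [Bf Df] [Bg Dg]; split=> //;
  try exact: stepOD.
by apply: diffO_eq (IH _ _ _ _ Df Dg) => e i _; lmod R; ring.
Qed.

Lemma diffOZ m L p (a : R) f : diffO m L p f -> diffO m L p (fun e i => a *: f e i).
Proof.
elim: m L p f => [|m IH] L p f /= [Bf Df]; split=> //; try exact: stepOZ.
by apply: diffO_eq (IH _ _ _ Df) => e i _; lmod R; ring.
Qed.

Lemma diffON m L p f : diffO m L p f -> diffO m L p (fun e i => - f e i).
Proof. by move/(diffOZ (-1)); apply: diffO_eq => e i _; rewrite scaleN1r. Qed.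

Lemma diffOB m L p f g : diffO m L p f -> diffO m L p g ->
  diffO m L p (fun e i => f e i - g e i).
Proof. by move=> Df /diffON; apply: diffOD. Qed.

Lemma diffO0 m L p : diffO m L p (fun _ _ => 0 : V).
Proof.
elim: m L p => [|m IH] L p /=; split=> //.
- by exists 0 => *; rewrite normr0 mul0r.
- by exists 0 => *; rewrite normr0 mul0r.
by apply: diffO_eq (IH _ _) => e i _; rewrite subr0.
Qed.

Lemma diffO_sum m L p (J : Type) (r : seq J) (P : pred J) (f : J -> I -> nat -> V) :
  (forall j, P j -> diffO m L p (f j)) ->
  diffO m L p (fun e i => \sum_(j <- r | P j) f j e i).
Proof.
move=> Df; elim: r => [|j r IH].
  by apply: diffO_eq (diffO0 _ _ _) => e i _; rewrite big_nil.
have [Pj|Pj] := boolP (P j).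
  by apply: diffO_eq (diffOD (Df j Pj) IH) => e i _; rewrite big_cons Pj.
by apply: diffO_eq IH => e i _; rewrite big_cons (negbTE Pj).
Qed.

Lemma diffO_scale m L p j f : diffO m L p f ->
  diffO m L (j + p) (fun e i => h e ^+ j *: f e i).
Proof.
elim: m L p f => [|m IH] L p f /= [[C HC] Df]; split=> //.
1,2: exists C => e i iL; have /andP[/ltW h0 _] := h01 e.
1,2: rewrite normrZ ger0_norm ?exprn_ge0 // exprD mulrCA.
1,2: by rewrite ler_wpM2l ?HC // exprn_ge0.
by have := IH _ _ _ Df; rewrite addnS; apply: diffO_eq => e i _; rewrite scalerBr.
Qed.

(** A small remainder needs no regularity: its differences are no larger
    than itself. *)
Lemma stepO_diffO m L p f : stepO L (p + m) f -> diffO m L p f.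
Proof.
elim: m L p f => [|m IH] L p f Bf /=.
  by split=> //; rewrite addn0 in Bf.
split; first by apply: stepO_le Bf => //; rewrite leq_addr.
apply: IH; rewrite addSnnS; have [C C0 HC] := stepO_ge0 Bf.
exists (C + C) => e i; rewrite ltn_predRL => iL.
rewrite mulrDl; apply: le_trans (ler_normB _ _) _.
by apply: lerD; apply: HC => //; exact: ltnW.
Qed.

(** Only [p] and [p + m], the orders of the term and of its last difference,
    matter. *)
Lemma diffO_weaken m m' L p p' f : (p' <= p)%N -> (p' + m' <= p + m)%N ->
  diffO m L p f -> diffO m' L p' f.
Proof.
elim: m m' L p p' f => [|m IH] m' L p p' f pp pm Df.
  apply: stepO_diffO; apply: stepO_le (diffO_stepO Df) => //.
  by rewrite addn0 in pm.
case: m' pm => [|m'] pm /=.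
  by split=> //; apply: stepO_le (diffO_stepO Df).
case: Df => Bf Df; split; first exact: stepO_le Bf.
by apply: IH Df; rewrite // !addSnnS.
Qed.

Lemma diffO_shift m L p f : diffO m L p f -> diffO m L.-1 p (fun e i => f e i.+1).
Proof.
elim: m L p f => [|m IH] L p f /= [[C HC] Df]; split=> //; last exact: (IH _ _ _ Df).
all: by exists C => e i iL; apply: HC; rewrite -ltn_predRL.
Qed.

End OneSpace.

Lemma stepO_pair (V W : normedModType R) L p (f : I -> nat -> V) (g : I -> nat -> W) :
  stepO L p f -> stepO L p g -> stepO L p (fun e i => (f e i, g e i)).
Proof.
move=> /stepO_ge0[C C0 HC] /stepO_ge0[C' C0' HC']; exists (C + C') => e i iL.
have /andP[h0 _] := h01 e; have hp : 0 <= h e ^+ p by rewrite exprn_ge0 // ltW.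
rewrite prod_normE ge_max mulrDl /=; apply/andP; split.
  by apply: le_trans (HC e i iL) _; rewrite lerDl mulr_ge0.
by apply: le_trans (HC' e i iL) _; rewrite lerDr mulr_ge0.
Qed.

Lemma diffO_pair (V W : normedModType R) m L p (f : I -> nat -> V) (g : I -> nat -> W) :
  diffO m L p f -> diffO m L p g -> diffO m L p (fun e i => (f e i, g e i)).
Proof.
elim: m L p f g => [|m IH] L p f g /= [Bf Df] [Bg Dg].
  by split=> //; apply: stepO_pair.
split; first exact: stepO_pair.
by apply: diffO_eq (IH _ _ _ _ Df Dg).
Qed.

Section TwoSpaces.
Variables (E G : normedModType R).

Lemma stepO_multilinear j L (p : 'I_j -> nat) (A : I -> ('I_j -> E) -> G) (M : R)
    (z : 'I_j -> I -> nat -> E) :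
  (forall e, opnorm_le M (A e)) -> (forall l, stepO L (p l) (z l)) ->
  stepO L (\sum_l p l) (fun e i => A e (fun l => z l e i)).
Proof.
move=> bA Bz; have /choice[C HC] l : exists C, forall e i, (i < L)%N ->
    `|z l e i| <= C * h e ^+ p l by have [C _ HC] := stepO_ge0 (Bz l); exists C.
exists (`|M| * \prod_l C l) => e i iL; rewrite -mulrA.
apply: le_trans (bA e _) _; apply: (@le_trans _ _ (`|M| * \prod_l `|z l e i|)).
  by rewrite ler_wpM2r ?ler_norm // prodr_ge0.
rewrite ler_wpM2l // expr_sum -big_split ler_prod //= => l _.
by rewrite normr_ge0 HC.
Qed.

(** Discrete Leibniz rule: differencing in [i] telescopes over the slots, and
    in each term exactly one slot is differenced, which gains one power of the
    step. *)
Lemma diffO_multilinear j m L (p : 'I_j -> nat) (A : I -> ('I_j -> E) -> G) (M : R)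
    (z : 'I_j -> I -> nat -> E) :
  (forall e, multilinear_map (A e)) -> (forall e, opnorm_le M (A e)) ->
  (forall l, diffO m L (p l) (z l)) ->
  diffO m L (\sum_l p l) (fun e i => A e (fun l => z l e i)).
Proof.
move=> mulA bA; elim: m L p z => [|m IH] L p z Dz /=.
  by split=> //; apply: stepO_multilinear => // l; apply: diffO_stepO (Dz l).
split; first by apply: stepO_multilinear => // l; apply: diffO_stepO (Dz l).
pose z' (l k : 'I_j) (e : I) (i : nat) : E :=
  splice (fun k => z k e i.+1) (fun k => z k e i.+1 - z k e i) (fun k => z k e i) l k.
suff Dl l : diffO m L.-1 (\sum_k p k).+1 (fun e i => A e (fun k => z' l k e i)).
  apply: diffO_eq (diffO_sum (index_enum 'I_j) (fun l _ => Dl l)) => e i _.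
  by rewrite multilinear_telescope.
have -> : (\sum_k p k).+1 = (\sum_k (p k + (k == l)))%N.
  have one : (\sum_(k < j) (k == l) = 1)%N.
    by rewrite (bigD1 l) //= eqxx big1 // => k /negbTE->.
  by rewrite big_split /= one addn1.
apply: IH => k; have [Bk Dk] := Dz k.
have Dk' : diffO m L (p k) (z k) by apply: diffO_weaken (Dz k); rewrite // leq_add2l.
rewrite /z' /splice -val_eqE; case: ltngtP => /= kl.
- by rewrite addn0; apply: (diffO_shift Dk').
- by rewrite addn0; apply: (diffO_narrow (leq_pred L) Dk').
- by rewrite addn1.
Qed.

(** Telescoping twice over the slots, once between [x] and [y] and once between
    the primed and the unprimed arguments: either two different slots carry a
    difference, which yields [p + q], or one slot carries the double difference,
    which yields [r]. *)
Lemma diffO_mixed_multilinear j m L (p q r s : nat) (A : I -> ('I_j -> E) -> G)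
    (M : R) (x y x' y' : I -> nat -> E) :
  (forall e, multilinear_map (A e)) -> (forall e, opnorm_le M (A e)) ->
  diffO m L 0 x -> diffO m L 0 y -> diffO m L 0 x' -> diffO m L 0 y' ->
  diffO m L p (fun e i => x e i - y e i) ->
  diffO m L p (fun e i => x' e i - y' e i) ->
  diffO m L q (fun e i => x e i - x' e i) ->
  diffO m L q (fun e i => y e i - y' e i) ->
  diffO m L r (fun e i => (x e i - y e i) - (x' e i - y' e i)) ->
  (s <= p + q)%N -> (s <= r)%N ->
  diffO m L s (fun e i => (A e (fun=> x e i) - A e (fun=> y e i))
                        - (A e (fun=> x' e i) - A e (fun=> y' e i))).
Proof.
move=> mulA bA Dx Dy Dx' Dy' Dxy Dxy' Dxx Dyy Dr spq sr.
pose a (l k : 'I_j) e i :=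
  splice (fun=> x e i) (fun=> x e i - y e i) (fun=> y e i) l k.
pose b (l k : 'I_j) e i :=
  splice (fun=> x' e i) (fun=> x' e i - y' e i) (fun=> y' e i) l k.
have le0 n f : diffO m L n f -> diffO m L 0 (f : I -> nat -> E).
  by apply: diffO_weaken => //; rewrite add0n leq_addl.
have Da l k : diffO m L (if k == l then p else 0%N) (a l k).
  by rewrite /a /splice -val_eqE; case: ltngtP.
have Db l k : diffO m L (if k == l then p else 0%N) (b l k).
  by rewrite /b /splice -val_eqE; case: ltngtP.
have Dab l k : diffO m L (if k == l then r else q) (fun e i => a l k e i - b l k e i).
  by rewrite /a /b /splice -val_eqE; case: ltngtP.
suff Dlk (l t : 'I_j) : diffO m L s (fun e i => A e (splice (fun k => a l k e i)
    (fun k => a l k e i - b l k e i) (fun k => b l k e i) t)).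
  apply: diffO_eq (diffO_sum (index_enum 'I_j) (fun l _ =>
    diffO_sum (index_enum 'I_j) (fun t _ => Dlk l t))) => e i _.
  rewrite !multilinear_telescope // -sumrB; apply: eq_bigr => l _.
  by rewrite [RHS]multilinear_telescope.
pose w (k : 'I_j) := if k == t then (if k == l then r else q)
                     else (if k == l then p else 0%N).
apply: (diffO_weaken (m := m) (p := (\sum_k w k)%N)); rewrite ?leq_add2r //.
1,2: rewrite (bigD1 t) //= {1}/w eqxx; case: eqP => [_|/eqP tl].
1,3: by rewrite (leq_trans sr) ?leq_addr.
1,2: rewrite (bigD1 l) 1?eq_sym //= /w eq_sym (negbTE tl) eqxx.
1,2: by rewrite addnA [(q + p)%N]addnC (leq_trans spq) ?leq_addr.
apply: (diffO_multilinear mulA bA) => k; rewrite /w /splice -val_eqE.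
by case: ltngtP => //= kt; rewrite ?Da ?Db //; apply: Dab.
Qed.

End TwoSpaces.
End DifferenceOrder.

(** * Weighted sums of samples of a curve and of its derivative *)

Section Quadrature.
Variables (R : realType) (X : normedModType R).
Implicit Types (U : nat -> R -> X) (cs ds : seq (R * R)).

(** The entries of [cs] and [ds] are pairs (abscissa, weight), the abscissas
    being measured from [t] in units of [k]. *)
Definition qsum U cs ds (t k : R) : X :=
  \sum_(c <- cs) c.2 *: U 0%N (t + c.1 * k)
  + \sum_(d <- ds) (d.2 * k) *: U 1%N (t + d.1 * k).

(** The coefficient of [k ^+ j *: U j t] in the Taylor expansion of [qsum], so
    that a weighted sum is of order [p] when its moments below [p] vanish. *)
Definition qmoment cs ds (j : nat) : R :=
  \sum_(c <- cs) c.2 * (c.1 ^+ j / j`!%:R)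
  + if j is j'.+1 then \sum_(d <- ds) d.2 * (d.1 ^+ j' / j'`!%:R) else 0.

Definition in01 (cs : seq (R * R)) := all (fun c => 0 <= c.1 <= 1) cs.

Section Jet.
Variables (n : nat) (a b M : R) (U : nat -> R -> X).
Hypothesis jU : jet n a b M U.

Lemma jet_dilate j m (s t k : R) : (j + m <= n)%N ->
  0 <= s <= 1 -> 0 <= k -> a <= t -> t + k <= b ->
  `|U j (t + s * k) - \sum_(l < m) (s ^+ l / l`!%:R * k ^+ l) *: U (j + l)%N t|
    <= `|M| * k ^+ m.
Proof.
move=> jm /andP[s0 s1] k0 at_ tkb; have sk0 : 0 <= s * k by rewrite mulr_ge0.
have sk : s * k <= k by rewrite ler_piMl.
have := @jet_taylor _ _ n a b M U jU j m t (t + s * k) jm at_.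
rewrite [t + s * k - t]addrAC subrr add0r => H.
under eq_bigr => l _ do rewrite mulrAC -exprMn.
apply: le_trans (H _ _) _; [by rewrite lerDl|by apply: le_trans tkb; rewrite lerD2l|].
apply: (@le_trans _ _ (`|M| * (s * k) ^+ m)).
  by rewrite ler_wpM2r ?ler_norm ?exprn_ge0.
by rewrite ler_wpM2l // lerXn2r ?nnegrE.
Qed.

Lemma qsum_taylor cs ds : (0 < n)%N -> in01 cs -> in01 ds ->
  exists C, forall t k, 0 <= k -> a <= t -> t + k <= b ->
  `|qsum U cs ds t k - \sum_(j < n) (qmoment cs ds j * k ^+ j) *: U j t|
    <= C * k ^+ n.
Proof.
move=> n0 cs01 ds01.
exists (\sum_(c <- cs) `|c.2| * `|M| + \sum_(d <- ds) `|d.2| * `|M|).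
move=> t k k0 at_ tkb.
rewrite (_ : _ - _ =
  (\sum_(c <- cs) c.2 *: (U 0%N (t + c.1 * k) -
     \sum_(l < n) (c.1 ^+ l / l`!%:R * k ^+ l) *: U (0 + l)%N t)) +
  (\sum_(d <- ds) (d.2 * k) *: (U 1%N (t + d.1 * k) -
     \sum_(l < n.-1) (d.1 ^+ l / l`!%:R * k ^+ l) *: U (1 + l)%N t))).
  rewrite mulrDl !mulr_suml; apply: le_trans (ler_normD _ _) _; apply: lerD.
    apply: le_trans (ler_norm_sum _ _ _) _; rewrite !big_seq.
    apply: ler_sum => c /(allP cs01) c01; rewrite normrZ -mulrA ler_wpM2l //.
    exact: jet_dilate.
  apply: le_trans (ler_norm_sum _ _ _) _; rewrite !big_seq.
  apply: ler_sum => d /(allP ds01) d01.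
  rewrite normrZ normrM (ger0_norm k0) -!mulrA ler_wpM2l //.
  have -> : `|M| * k ^+ n = k * (`|M| * k ^+ n.-1).
    by rewrite mulrCA -exprS prednK.
  by rewrite ler_wpM2l //; apply: jet_dilate => //; rewrite add1n prednK.
rewrite /qsum; under [in RHS]eq_bigr do rewrite scalerBr.
under [X in _ = _ + X]eq_bigr do rewrite scalerBr.
rewrite !sumrB.
suff -> : \sum_(j < n) (qmoment cs ds j * k ^+ j) *: U j t =
    \sum_(c <- cs) c.2 *: (\sum_(l < n) (c.1 ^+ l / l`!%:R * k ^+ l) *: U (0 + l)%N t) +
    \sum_(d <- ds) (d.2 * k) *:
      (\sum_(l < n.-1) (d.1 ^+ l / l`!%:R * k ^+ l) *: U (1 + l)%N t).
  by rewrite opprD addrACA.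
under eq_bigr do rewrite mulrDl scalerDl.
rewrite big_split /=; congr (_ + _).
  under [RHS]eq_bigr do rewrite scaler_sumr.
  rewrite exchange_big; apply: eq_bigr => j _.
  rewrite !mulr_suml scaler_suml; apply: eq_bigr => c _.
  by rewrite scalerA -mulrA.
case: n n0 => // m _; rewrite big_ord_recl mul0r scale0r add0r /=.
under [RHS]eq_bigr do rewrite scaler_sumr.
rewrite exchange_big; apply: eq_bigr => j _.
rewrite !mulr_suml scaler_suml; apply: eq_bigr => d _.
by rewrite scalerA exprS; congr (_ *: _); ring.
Qed.

End Jet.

Section Samples.
Variables (I : Type) (h t0 : I -> R).
Hypothesis h01 : forall e, 0 < h e <= 1.

Definition node (e : I) (i : nat) : R := t0 e + i%:R * h e.

Variables (n L : nat) (a b M : R) (U : nat -> R -> X).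
Hypothesis jU : jet n a b M U.
Hypothesis t0a : forall e, a <= t0 e.
Hypothesis t0b : forall e, t0 e + L%:R * h e <= b.

Lemma node_ge e i : a <= node e i.
Proof.
by rewrite (le_trans (t0a e)) // lerDl mulr_ge0 //; case/andP: (h01 e) => /ltW.
Qed.

Lemma node_le e i (s : R) : (i < L)%N -> s <= 1 -> node e i + s * h e <= b.
Proof.
move=> iL s1; apply: le_trans (t0b e); rewrite -addrA lerD2l -mulrDl.
rewrite ler_wpM2r //; first by case/andP: (h01 e) => /ltW.
have : i.+1%:R <= L%:R :> R by rewrite ler_nat.
by rewrite -natr1; lra.
Qed.

Lemma node_in e i (s : R) : (i < L)%N -> 0 <= s <= 1 ->
  a <= node e i + s * h e <= b.
Proof.
move=> iL /andP[s0 s1]; rewrite node_le // andbT (le_trans (node_ge e i)) //.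
by rewrite lerDl mulr_ge0 //; case/andP: (h01 e) => /ltW.
Qed.

(** A difference of samples of [U j] is a Taylor sum of samples of higher
    derivatives, each with a positive power of the step; hence the induction on
    the number [m] of differences. *)
Lemma diffO_sample j m : (j + m <= n)%N ->
  diffO h m L 0 (fun e i => U j (node e i)).
Proof.
have [dU bU] := jU.
have [k] := ubnP m; elim: k m j => // k IH m j mk jm.
have B : stepO h L 0 (fun e i => U j (node e i)).
  exists M => e i iL; rewrite expr0 mulr1; apply: bU.
    by apply: leq_trans jm; rewrite leq_addr.
  by have := @node_in e i 0 iL; rewrite mul0r addr0 lexx ler01; apply.
case: m mk jm => [|m] mk jm /=; first by split.
split=> //.
have D (l : 'I_m) : diffO h m L.-1 1 (fun e i =>
    (l.+1`!%:R^-1 : R) *: (h e ^+ l.+1 *: U (j + l.+1)%N (node e i))).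
  apply: diffOZ; apply: (diffO_weaken h01 (m := m - l) (p := l.+1 + 0)).
  - by rewrite addn0.
  - by have := ltn_ord l; lia.
  apply: diffO_scale => //; apply: (diffO_narrow h01 (leq_pred L)).
  by apply: IH; have := ltn_ord l; lia.
pose r e i := U j (node e i.+1) -
  \sum_(l < m.+1) (1 ^+ l / l`!%:R * h e ^+ l) *: U (j + l)%N (node e i).
have Dr : diffO h m L.-1 1 r.
  apply: stepO_diffO => //; exists `|M| => e i; rewrite ltn_predRL => iL.
  have /andP[h0 h1] := h01 e.
  have := @jet_dilate n a b M U jU j m.+1 1 (node e i) (h e) jm.
  rewrite lexx ler01 mul1r /r add1n /node -natr1 mulrDl mul1r addrA; apply=> //.
  - exact: ltW.
  - exact: node_ge.
  - by have := @node_le e i 1 (ltnW iL) (lexx _); rewrite mul1r.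
apply: diffO_eq (diffOD Dr (diffO_sum (P := xpredT) (index_enum 'I_m) (fun l _ => D l))).
move=> e i _; rewrite /r big_ord_recl /= addn0 !expr0 divr1 mulr1 scale1r.
under [X in _ - (_ + X)]eq_bigr => l _ do rewrite /bump leq0n add1n expr1n div1r -scalerA.
by rewrite opprD addrA subrK.
Qed.

Lemma diffO_qsum cs ds m p : (0 < n)%N -> in01 cs -> in01 ds -> (p + m <= n)%N ->
  (forall j, (j < p)%N -> qmoment cs ds j = 0) ->
  diffO h m L p (fun e i => qsum U cs ds (node e i) (h e)).
Proof.
move=> n0 cs01 ds01 pmn mom0.
have [C HC] := qsum_taylor jU n0 cs01 ds01.
pose r e i := qsum U cs ds (node e i) (h e) -
  \sum_(j < n) (qmoment cs ds j * h e ^+ j) *: U j (node e i).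
have Dr : diffO h m L p r.
  apply: (diffO_weaken h01 (m := 0) (p := n)); [lia|lia|].
  split=> //; exists C => e i iL; apply: HC.
  - by case/andP: (h01 e) => /ltW.
  - exact: node_ge.
  - by have := @node_le e i 1 iL (lexx _); rewrite mul1r.
have D (j : 'I_n) : diffO h m L p (fun e i =>
    qmoment cs ds j *: (h e ^+ j *: U j (node e i))).
  have [jp|pj] := ltnP j p.
    by apply: diffO_eq (diffO0 h X m L p) => e i _; rewrite mom0 // scale0r.
  apply: diffOZ; apply: (diffO_weaken h01 (m := n - j) (p := j + 0)).
  - by rewrite addn0.
  - by have := ltn_ord j; lia.
  apply: diffO_scale => //; apply: diffO_sample.
  by have := ltn_ord j; lia.
apply: diffO_eq (diffOD Dr (diffO_sum (P := xpredT) (index_enum 'I_n) (fun j _ => D j))).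
move=> e i _; rewrite /r; under [X in _ + X]eq_bigr do rewrite scalerA.
by rewrite subrK.
Qed.

End Samples.
End Quadrature.

Ltac vanishing_moments :=
  by case=> [|[|[|[|[|[|[|?]]]]]]] // _;
    rewrite /qmoment !(big_cons, big_nil) /= /factorial /=; field.

(** * Smooth maps on such sequences, and the error of the Runge-Kutta substeps *)

Section SmoothMap.
Variables (R : realType) (I : Type) (h : I -> R).
Hypothesis h01 : forall e, 0 < h e <= 1.
Variables (E G : normedModType R) (n m L : nat) (D : set E) (f : E -> G).
Variables (c : I -> E) (A : forall j : nat, E -> ('I_j -> E) -> G) (M : R).
Arguments A : clear implicits.
Hypothesis mulA : forall j e, (j < n)%N ->
  multilinear_map (A j (c e)) /\ opnorm_le M (A j (c e)).
Hypothesis taylorf : forall e z, D (c e + z) ->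
  `|f (c e + z) - \sum_(j < n) j`!%:R^-1 *: A j (c e) (fun=> z)|
    <= M * `|z| ^+ n.

(** Sequences along which [f] may be replaced by its Taylor polynomial at
    [c e]: they stay at distance O(h) from the base point, so that the remainder
    of order [n] is O(h^n). *)
Definition close_base (x : I -> nat -> E) : Prop :=
  [/\ forall e i, (i < L)%N -> D (x e i),
      diffO h m L 0 (fun e i => x e i - c e)
    & stepO h L 1 (fun e i => x e i - c e)].

Lemma taylor_remainder x : close_base x -> stepO h L n (fun e i => f (x e i) -
  \sum_(j < n) j`!%:R^-1 *: A j (c e) (fun=> x e i - c e)).
Proof.
case=> Dx _ /(stepO_ge0 h01)[C C0 HC]; exists (`|M| * C ^+ n) => e i iL.
have := taylorf (e := e) (z := x e i - c e); rewrite addrC subrK => H.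
apply: le_trans (H (Dx e i iL)) _; rewrite -mulrA -exprMn.
apply: (@le_trans _ _ (`|M| * `|x e i - c e| ^+ n)).
  by rewrite ler_wpM2r ?ler_norm // exprn_ge0.
have := HC e i iL; rewrite expr1 => H1.
by rewrite ler_wpM2l // lerXn2r ?nnegrE // (le_trans _ H1).
Qed.

(** A smooth map acts on mixed second differences like its Taylor polynomial,
    because a remainder O(h^n) is compatible with [m] differences of order [s]
    as soon as [s + m <= n]. This one statement replaces the regularity of the
    derivatives of [F] along the solution. *)
Lemma diffO_mixed p q r s x y x' y' :
  close_base x -> close_base y -> close_base x' -> close_base y' ->
  diffO h m L p (fun e i => x e i - y e i) ->
  diffO h m L p (fun e i => x' e i - y' e i) ->
  diffO h m L q (fun e i => x e i - x' e i) ->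
  diffO h m L q (fun e i => y e i - y' e i) ->
  diffO h m L r (fun e i => (x e i - y e i) - (x' e i - y' e i)) ->
  (s <= p + q)%N -> (s <= r)%N -> (s + m <= n)%N ->
  diffO h m L s (fun e i => (f (x e i) - f (y e i)) - (f (x' e i) - f (y' e i))).
Proof.
move=> Bx By Bx' By' Dxy Dxy' Dxx Dyy Dr spq sr smn.
pose rem (z : I -> nat -> E) e i := f (z e i) -
  \sum_(j < n) j`!%:R^-1 *: A j (c e) (fun=> z e i - c e).
have Drem z : close_base z -> diffO h m L s (rem z).
  move=> Bz; apply: stepO_diffO => //.
  by apply: (stepO_le h01 _ smn (taylor_remainder Bz)).
have Dpoly (j : 'I_n) : diffO h m L s (fun e i => j`!%:R^-1 *:
    ((A j (c e) (fun=> x e i - c e) - A j (c e) (fun=> y e i - c e)) -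
     (A j (c e) (fun=> x' e i - c e) - A j (c e) (fun=> y' e i - c e)))).
  apply: diffOZ.
  have sub (u v : I -> nat -> E) k : diffO h m L k (fun e i => u e i - v e i) ->
      diffO h m L k (fun e i => (u e i - c e) - (v e i - c e)).
    by apply: diffO_eq => e i _; rewrite opprB addrA subrK.
  have mulj e : multilinear_map (A j (c e)) by have [] := @mulA j e (ltn_ord j).
  have bj e : opnorm_le M (A j (c e)) by have [] := @mulA j e (ltn_ord j).
  apply: (diffO_mixed_multilinear h01 mulj bj (p := p) (q := q) (r := r)) => //;
    try exact: sub.
  - by case: Bx.
  - by case: By.
  - by case: Bx'.
  - by case: By'.
  by apply: diffO_eq Dr => e i _; lmod R; ring.
apply: diffO_eq (diffOD (diffOB (diffOB (Drem x Bx) (Drem y By))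
    (diffOB (Drem x' Bx') (Drem y' By')))
  (diffO_sum (P := xpredT) (index_enum 'I_n) (fun j _ => Dpoly j))) => e i _.
pose P (z : I -> nat -> E) := \sum_(j < n) j`!%:R^-1 *: A j (c e) (fun=> z e i - c e).
rewrite (_ : \sum_(j < n) _ = (P x - P y) - (P x' - P y')).
  by rewrite /rem -!/(P _); lmod R; ring.
by rewrite -!sumrB; apply: eq_bigr => j _; rewrite !scalerBr.
Qed.

End SmoothMap.

Section RungeKutta.
Variables (R : realType) (X : normedModType R) (T M : R) (u : R -> X).
Variables (F : R * X -> X) (U : nat -> R -> X).
Hypothesis jU : jet 7 0 T M U.
Hypothesis U0 : forall t : R, 0 <= t <= T -> U 0%N t = u t.
Hypothesis U1 : forall t : R, 0 <= t <= T -> U 1%N t = F (t, u t).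
Let D := [set p : R * X | 0 <= p.1 <= T].
Variable A : forall j : nat, R * X -> ('I_j -> R * X) -> X.
Arguments A : clear implicits.
Variable B : R.
Hypothesis mulA : forall j (t : R), (j < 6)%N -> 0 <= t <= T ->
  multilinear_map (A j (t, u t)) /\ opnorm_le B (A j (t, u t)).
Hypothesis taylorF : forall (t : R) (z : R * X), 0 <= t <= T -> D ((t, u t) + z) ->
  `|F ((t, u t) + z) - \sum_(j < 6) j`!%:R^-1 *: A j (t, u t) (fun=> z)|
    <= B * `|z| ^+ 6.
Variables (I : Type) (h t0 : I -> R).
Hypothesis h01 : forall e, 0 < h e <= 1.
Hypothesis t0_ge0 : forall e, 0 <= t0 e.
Hypothesis t0_le : forall e, t0 e + 5 * h e <= T.

Section Step.
Variables (m L : nat).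
Hypothesis L5 : (L <= 5)%N.
Hypothesis m2 : (m <= 2)%N.

Let t0L e : t0 e + L%:R * h e <= T.
Proof.
apply: le_trans (t0_le e); rewrite lerD2l ler_wpM2r //.
  by case/andP: (h01 e) => /ltW.
by rewrite (ler_nat _ L 5).
Qed.

Let t0T e : 0 <= t0 e <= T.
Proof.
rewrite t0_ge0 (le_trans _ (t0_le e)) // lerDl mulr_ge0 //.
by case/andP: (h01 e) => /ltW.
Qed.

Let c e : R * X := (t0 e, u (t0 e)).
Let mesh (s : R) e i : R := node h t0 e i + s * h e.
Let close := close_base h m L D c.

Let mesh_in (s : R) e i : 0 <= s <= 1 -> (i < L)%N -> 0 <= mesh s e i <= T.
Proof. by move=> s01 iL; apply: (node_in h01 t0_ge0 t0L). Qed.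

Lemma mesh_sub s e i : mesh s e i - t0 e = (i%:R + s) * h e.
Proof. by rewrite /mesh /node; ring. Qed.

Lemma mesh_sub_le s e i : 0 <= s <= 1 -> (i < L)%N ->
  `|mesh s e i - t0 e| <= 5 * h e.
Proof.
move=> /andP[s0 s1] iL; have /andP[h0 _] := h01 e.
rewrite mesh_sub normrM (gtr0_norm h0) ler_wpM2r ?(ltW h0) // ger0_norm ?addr_ge0 //.
have : i.+1%:R <= 5 :> R by rewrite (ler_nat _ i.+1 5) (leq_trans iL).
by rewrite -[i.+1%:R]natr1; lra.
Qed.

Lemma diffO_mesh s : 0 <= s <= 1 -> diffO h m L 0 (fun e i => mesh s e i - t0 e : R).
Proof.
move=> s01; have Dh k l : diffO h k l 1 (fun e _ => h e : R).
  have S l' : stepO h l' 1 (fun e _ => h e : R).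
    by exists 1 => e i _; have /andP[h0 _] := h01 e; rewrite mul1r gtr0_norm.
  case: k => [|k]; split=> //.
  by apply: diffO_eq (diffO0 h R k l.-1 2) => e i _; rewrite subrr.
have S : stepO h L 0 (fun e i => mesh s e i - t0 e : R).
  exists 5 => e i iL; have /andP[h0 h1] := h01 e.
  by apply: le_trans (mesh_sub_le e s01 iL) _; rewrite expr0 ler_wpM2l.
case: m => [|k]; split=> //; apply: diffO_eq (Dh k L.-1) => e i _.
by rewrite !mesh_sub -natr1; ring.
Qed.

Lemma diffO_exact_comb cs ds p : in01 cs -> in01 ds -> (p <= 5)%N ->
  (forall j, (j < p)%N -> qmoment cs ds j = 0) ->
  diffO h m L p (fun e i => \sum_(c <- cs) c.2 *: u (mesh c.1 e i)
    + \sum_(d <- ds) (d.2 * h e) *: F (mesh d.1 e i, u (mesh d.1 e i))).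
Proof.
move=> cs01 ds01 p5 mom0.
have pm : (p + m <= 7)%N by rewrite (leq_add p5 m2).
apply: diffO_eq (diffO_qsum h01 jU t0_ge0 t0L isT cs01 ds01 pm mom0) => e i iL.
rewrite /qsum -/(mesh _ _ _) !big_seq; congr (_ + _).
  by apply: eq_bigr => q /(allP cs01) q01; rewrite U0 //; apply: mesh_in.
by apply: eq_bigr => q /(allP ds01) q01; rewrite U1 //; apply: mesh_in.
Qed.

Lemma close_exact s : 0 <= s <= 1 -> close (fun e i => (mesh s e i, u (mesh s e i))).
Proof.
move=> s01; split=> [e i iL||]; first exact: mesh_in.
  apply: diffO_pair => //; first exact: diffO_mesh.
  apply: diffOB.
    have cs01 : in01 [:: (s, 1)] by rewrite /in01 /= s01.
    have := @diffO_exact_comb [:: (s, 1)] [::] 0%N cs01 isT isT.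
    move=> /(_ _)/diffO_eq; apply=> // e i _.
    by rewrite big_seq1 big_nil addr0 scale1r.
  have S l : stepO h l 0 (fun e _ => u (t0 e)).
    exists M => e i _; rewrite expr0 mulr1 -U0 //; case: jU => _ bU.
    exact: bU.
  case: m => [|k]; split=> //.
  by apply: diffO_eq (diffO0 h X k L.-1 1) => e i _; rewrite subrr.
apply: stepO_pair => //.
  by exists 5 => e i iL; rewrite expr1; apply: mesh_sub_le.
exists (`|M| * 5) => e i iL; rewrite expr1 /= -!U0 //; last exact: mesh_in.
apply: le_trans (jet_lipschitz jU isT (t0T e) (mesh_in e s01 iL)) _.
apply: (@le_trans _ _ (`|M| * `|mesh s e i - t0 e|)).
  by rewrite ler_wpM2r ?ler_norm.
by rewrite -mulrA ler_wpM2l // mesh_sub_le.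
Qed.

Lemma close_pert s p (a : I -> nat -> X) : 0 <= s <= 1 -> (0 < p)%N ->
  diffO h m L p a -> close (fun e i => (mesh s e i, u (mesh s e i) + a e i)).
Proof.
move=> s01 p0 Da; have [_ Dx Sx] := close_exact s01.
have pair0 e i : (mesh s e i, u (mesh s e i) + a e i) - c e =
    ((mesh s e i, u (mesh s e i)) - c e) + (0, a e i).
  by congr (_, _) => /=; rewrite ?addr0 // addrAC.
have D0 : diffO h m L p (fun e i => (0, a e i) : R * X).
  exact: (diffO_pair h01 (diffO0 h R m L p) Da).
split=> [e i iL||]; first exact: mesh_in.
  have D0' := diffO_weaken h01 (leq0n p) (leq_addl p m) D0.
  by apply: diffO_eq (diffOD Dx D0') => e i _; rewrite pair0.
have [C HC] := stepOD Sx (stepO_le h01 (leqnn L) p0 (diffO_stepO D0)).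
by exists C => e i iL; rewrite pair0; apply: HC.
Qed.

Lemma close_center : close (fun e _ => c e).
Proof.
split=> [e i iL||]; first exact: t0T.
  by apply: diffO_eq (diffO0 h _ m L 0) => e i _; rewrite subrr.
by exists 0 => e i iL; rewrite subrr normr0 mul0r.
Qed.

Let mulAc j e : (j < 6)%N -> multilinear_map (A j (c e)) /\ opnorm_le B (A j (c e)).
Proof. by move=> j6; apply: mulA. Qed.

Let taylorc e z : D (c e + z) ->
  `|F (c e + z) - \sum_(j < 6) j`!%:R^-1 *: A j (c e) (fun=> z)| <= B * `|z| ^+ 6.
Proof. by move=> Dz; apply: taylorF. Qed.

Let mixed := @diffO_mixed _ _ _ h01 _ _ 6 m L D F c A B mulAc taylorc.

(** The change in [F] caused by a perturbation [a] of the exact solution at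
    the points [t_i + s h]. *)
Definition Fdefect (s : R) (a : I -> nat -> X) e i : X :=
  F (mesh s e i, u (mesh s e i) + a e i) - F (mesh s e i, u (mesh s e i)).

Let vertical p a : diffO h m L p a -> diffO h m L p (fun e i => (0, a e i) : R * X).
Proof. by move=> Da; apply: (diffO_pair h01 (diffO0 h R m L p) Da). Qed.

(** The perturbation is differenced once and the base point is constant: a
    mixed difference with trivial second direction. *)
Lemma diffO_Fdefect s p a : 0 <= s <= 1 -> (0 < p)%N -> (p <= 4)%N ->
  diffO h m L p a -> diffO h m L p (Fdefect s a).
Proof.
move=> s01 p0 p4 Da; have [_ Dx _] := close_exact s01.
have [_ Dx' _] := close_pert s01 p0 Da.
have Dp := vertical Da.
have z : diffO h m L p (fun e i => c e - c e).
  by apply: diffO_eq (diffO0 h _ m L p) => e i _; rewrite subrr.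
have xy e i : (mesh s e i, u (mesh s e i) + a e i) - (mesh s e i, u (mesh s e i))
    = (0, a e i) :> R * X.
  by congr (_, _) => /=; [rewrite subrr|lmod R; ring].
have := mixed (close_pert s01 p0 Da) (close_exact s01) close_center close_center
  (p := p) (q := 0) (r := p) (s := p) _ z Dx' Dx.
rewrite addn0 leqnn (leq_add p4 m2) => H.
apply: diffO_eq (H _ _ isT isT isT) => [e i _||].
- by rewrite subrr subr0.
- by apply: diffO_eq Dp => e i _; rewrite xy.
- by apply: diffO_eq Dp => e i _; rewrite xy subrr subr0.
Qed.

(** Replaces the linearity of the derivative of [F]: the defect is additive up
    to a product of the two perturbations. *)
Lemma diffO_Fdefect_add s p q k a b : 0 <= s <= 1 -> (0 < p)%N -> (0 < q)%N ->
  (k <= p + q)%N -> (k <= 4)%N -> diffO h m L p a -> diffO h m L q b ->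
  diffO h m L k (fun e i => Fdefect s (fun e i => a e i + b e i) e i
                          - Fdefect s a e i - Fdefect s b e i).
Proof.
move=> s01 p0 q0 kpq k4 Da Db.
have Dab : diffO h m L 1 (fun e i => a e i + b e i).
  by apply: diffOD; [apply: diffO_weaken Da|apply: diffO_weaken Db];
    rewrite // leq_add2r.
have := mixed (close_pert s01 (ltn0Sn 0) Dab) (close_pert s01 q0 Db)
  (close_pert s01 p0 Da) (close_exact s01) (p := p) (q := q) (r := k) (s := k).
rewrite kpq leqnn (leq_add k4 m2) => H.
apply: diffO_eq (H _ _ _ _ _ isT isT isT) => [e i _|||||].
- by rewrite /Fdefect; lmod R; ring.
- apply: diffO_eq (vertical Da) => e i _.
  by congr (_, _) => /=; [rewrite subrr|lmod R; ring].
- apply: diffO_eq (vertical Da) => e i _.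
  by congr (_, _) => /=; [rewrite subrr|lmod R; ring].
- apply: diffO_eq (vertical Db) => e i _.
  by congr (_, _) => /=; [rewrite subrr|lmod R; ring].
- apply: diffO_eq (vertical Db) => e i _.
  by congr (_, _) => /=; [rewrite subrr|lmod R; ring].
- apply: diffO_eq (diffO0 h _ m L k) => e i _.
  by congr (_, _) => /=; [rewrite !subrr|lmod R; ring].
Qed.

(** Replaces the continuity of the derivative of [F] along the solution:
    moving the point by O(h) costs one order. *)
Lemma diffO_Fdefect_move s s' p a : 0 <= s <= 1 -> 0 <= s' <= 1 ->
  (0 < p)%N -> (p < 4)%N -> diffO h m L p a ->
  diffO h m L p.+1 (fun e i => Fdefect s a e i - Fdefect s' a e i).
Proof.
move=> s01 s01' p0 p4 Da.
have Dss : diffO h m L 1 (fun e i =>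
    (mesh s e i, u (mesh s e i)) - (mesh s' e i, u (mesh s' e i)) : R * X).
  have cs01 : in01 [:: (s, 1); (s', -1)] by rewrite /in01 /= s01 s01'.
  have mom : forall j, (j < 1)%N -> qmoment [:: (s, 1); (s', -1)] [::] j = 0.
    by case=> // _; rewrite /qmoment !big_cons big_nil /= !expr0; lra.
  have Du : diffO h m L 1 (fun e i => u (mesh s e i) - u (mesh s' e i)).
    apply: diffO_eq (@diffO_exact_comb _ [::] 1 cs01 isT isT mom) => e i _.
    by rewrite !big_cons !big_nil /=; lmod R; ring.
  have S l : stepO h l 1 (fun e _ => (s - s') * h e : R).
    exists `|s - s'| => e i _; have /andP[h0 _] := h01 e.
    by rewrite normrM (gtr0_norm h0) expr1.
  have Dm : diffO h m L 1 (fun e _ => (s - s') * h e : R).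
    case: m => [|k]; split=> //.
    by apply: diffO_eq (diffO0 h R k L.-1 2) => e i _; rewrite subrr.
  apply: diffO_eq (diffO_pair h01 Dm Du) => e i _; congr (_, _) => /=.
  by rewrite /mesh; ring.
have := mixed (close_pert s01 p0 Da) (close_exact s01)
  (close_pert s01' p0 Da) (close_exact s01') (p := p) (q := 1%N) (r := p.+1) (s := p.+1).
rewrite addn1 leqnn (leq_add p4 m2) => H.
apply: diffO_eq (H _ _ _ _ _ isT isT isT) => [e i _|||||].
- by [].
- apply: diffO_eq (vertical Da) => e i _.
  by congr (_, _) => /=; [rewrite subrr|lmod R; ring].
- apply: diffO_eq (vertical Da) => e i _.
  by congr (_, _) => /=; [rewrite subrr|lmod R; ring].
- apply: diffO_eq Dss => e i _.
  by congr (_, _) => /=; lmod R; ring.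
- by [].
- apply: diffO_eq (diffO0 h _ m L p.+1) => e i _.
  by congr (_, _) => /=; [rewrite !subrr|lmod R; ring].
Qed.

Let um (s : R) e i : X := u (mesh s e i).
Let fm (s : R) e i : X := F (mesh s e i, u (mesh s e i)).

Let half01 : 0 <= (2^-1 : R) <= 1.
Proof. by apply/andP; split; lra. Qed.

Lemma diffO_exact_thirds (c0 ch c1 d0 dh d1 : R) p : (p <= 5)%N ->
  (forall j, (j < p)%N -> qmoment [:: (0, c0); (2^-1, ch); (1, c1)]
                                  [:: (0, d0); (2^-1, dh); (1, d1)] j = 0) ->
  diffO h m L p (fun e i =>
    c0 *: um 0 e i + ch *: um 2^-1 e i + c1 *: um 1 e i +
    h e *: (d0 *: fm 0 e i + dh *: fm 2^-1 e i + d1 *: fm 1 e i)).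
Proof.
move=> p5 mom0.
have gen (r s t : R) : 0 <= r <= 1 -> 0 <= s <= 1 -> 0 <= t <= 1 ->
    (forall j, (j < p)%N -> qmoment [:: (r, c0); (s, ch); (t, c1)]
                                  [:: (r, d0); (s, dh); (t, d1)] j = 0) ->
    diffO h m L p (fun e i =>
      c0 *: um r e i + ch *: um s e i + c1 *: um t e i +
      h e *: (d0 *: fm r e i + dh *: fm s e i + d1 *: fm t e i)).
  move=> r01 s01 t01 mom; have in3 (x y z : R) : in01 [:: (r, x); (s, y); (t, z)].
    by rewrite /in01 /= r01 s01 t01.
  apply: diffO_eq (diffO_exact_comb (in3 _ _ _) (in3 _ _ _) p5 mom) => e i _.
  by rewrite !(big_cons, big_nil) /= /um /fm; lmod R; ring.
by apply: (gen _ _ _ _ half01) => //; rewrite !lexx ?ler01.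
Qed.

Lemma diffO_hscale p (a : I -> nat -> X) :
  diffO h m L p a -> diffO h m L p.+1 (fun e i => h e *: a e i).
Proof. by move/(diffO_scale h01 1). Qed.

(** Write [a2], [a3], [a4] for the differences between the internal stages and
    the exact solution, and [n1], ..., [n4] for the defects that they cause. The
    exact slopes combine to Simpson's rule, whose error has order 5, so it remains
    to see that [n1 + 2 n2 + 2 n3 + n4] has order 4. The defects have order 2, 2 and
    3 only, but being additive up to order 4 they sum to the defect of
    [g = 2 (a2 + a3) + a4]; in this combination the Taylor terms of the exact
    solution cancel up to order 4, and what is left of the stages is
    [h (n2 + n3)], of order 4 again by additivity. *)
Lemma diffO_rk4_increment (v : I -> nat -> X) :
  diffO h m L 4 (fun e i => v e i - um 0 e i) ->
  diffO h m L 5 (fun e i =>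
    (rk4_step F (h e) (node h t0 e i) (v e i) - v e i) - (um 1 e i - um 0 e i)).
Proof.
set a1 := (fun e i => v e i - um 0 e i) => Da1.
have i0 : 0 <= (0 : R) <= 1 by rewrite lexx ler01.
have i1 : 0 <= (1 : R) <= 1 by rewrite lexx ler01.
have weak p q a : (q <= p)%N -> diffO h m L p a -> diffO h m L q (a : I -> nat -> X).
  by move=> qp Da; apply: (diffO_weaken h01 qp _ Da); rewrite leq_add2r.
have FE s (w : I -> nat -> X) e i : F (mesh s e i, w e i) =
    fm s e i + Fdefect s (fun e i => w e i - um s e i) e i.
  by rewrite /Fdefect /= -/(um _ _ _) [um s e i + _]addrC subrK -/(fm _ _ _) addrC subrK.
pose K1 e i := F (mesh 0 e i, v e i).
pose Y2 e i := v e i + (h e / 2) *: K1 e i.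
pose K2 e i := F (mesh 2^-1 e i, Y2 e i).
pose Y3 e i := v e i + (h e / 2) *: K2 e i.
pose K3 e i := F (mesh 2^-1 e i, Y3 e i).
pose Y4 e i := v e i + h e *: K3 e i.
pose K4 e i := F (mesh 1 e i, Y4 e i).
have rkE e i : rk4_step F (h e) (node h t0 e i) (v e i) =
    v e i + (h e / 6) *: (K1 e i + 2 *: K2 e i + 2 *: K3 e i + K4 e i).
  rewrite /rk4_step /K4 /Y4 /K3 /Y3 /K2 /Y2 /K1.
  have -> : mesh 0 e i = node h t0 e i by rewrite /mesh mul0r addr0.
  have -> : mesh 1 e i = node h t0 e i + h e by rewrite /mesh mul1r.
  by have -> : mesh 2^-1 e i = node h t0 e i + h e / 2 by rewrite /mesh mulrC.
pose a2 e i := Y2 e i - um 2^-1 e i.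
pose a3 e i := Y3 e i - um 2^-1 e i.
pose a4 e i := Y4 e i - um 1 e i.
pose n1 := Fdefect 0 a1. pose n2 := Fdefect 2^-1 a2.
pose n3 := Fdefect 2^-1 a3. pose n4 := Fdefect 1 a4.
have K1E e i : K1 e i = fm 0 e i + n1 e i := FE 0 v e i.
have K2E e i : K2 e i = fm 2^-1 e i + n2 e i := FE 2^-1 Y2 e i.
have K3E e i : K3 e i = fm 2^-1 e i + n3 e i := FE 2^-1 Y3 e i.
have K4E e i : K4 e i = fm 1 e i + n4 e i := FE 1 Y4 e i.
have Dn1 : diffO h m L 4 n1 by apply: diffO_Fdefect.
have Dhn1 := diffO_hscale Dn1.
have Da2 : diffO h m L 2 a2.
  have Q : diffO h m L 2 _ := @diffO_exact_thirds 1 (-1) 0 2^-1 0 0 2 isT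
    ltac:(vanishing_moments).
  apply: diffO_eq (diffOD (diffOD Q (weak 4 2 _ isT Da1))
    (diffOZ 2^-1 (weak 5 2 _ isT Dhn1))) => e i _.
  by rewrite /a2 /Y2 K1E /a1; lmod R; field.
have Dn2 : diffO h m L 2 n2 by apply: diffO_Fdefect.
have Dhn2 := diffO_hscale Dn2.
have Da3 : diffO h m L 2 a3.
  have Q : diffO h m L 2 _ := @diffO_exact_thirds 1 (-1) 0 0 2^-1 0 2 isT
    ltac:(vanishing_moments).
  apply: diffO_eq (diffOD (diffOD Q (weak 4 2 _ isT Da1))
    (diffOZ 2^-1 (weak 3 2 _ isT Dhn2))) => e i _.
  by rewrite /a3 /Y3 K2E /a1; lmod R; field.
have Dn3 : diffO h m L 2 n3 by apply: diffO_Fdefect.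
have Dhn3 := diffO_hscale Dn3.
have Da4 : diffO h m L 3 a4.
  have Q : diffO h m L 3 _ := @diffO_exact_thirds 1 0 (-1) 0 1 0 3 isT
    ltac:(vanishing_moments).
  apply: diffO_eq (diffOD (diffOD Q (weak 4 3 _ isT Da1)) Dhn3) => e i _.
  by rewrite /a4 /Y4 K3E /a1; lmod R; field.
pose b e i := a2 e i + a3 e i.
have Db : diffO h m L 3 b.
  have Q : diffO h m L 3 _ := @diffO_exact_thirds 2 (-2) 0 2^-1 2^-1 0 3 isT
    ltac:(vanishing_moments).
  apply: diffO_eq (diffOD (diffOD Q (diffOZ 2 (weak 4 3 _ isT Da1)))
    (diffOZ 2^-1 (diffOD (weak 5 3 _ isT Dhn1) Dhn2))) => e i _.
  by rewrite /b /a2 /a3 /Y2 /Y3 K1E K2E /a1; lmod R; field.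
have Dnb : diffO h m L 3 (Fdefect 2^-1 b) by apply: diffO_Fdefect.
have Dn23 : diffO h m L 4 (fun e i => Fdefect 2^-1 b e i - n2 e i - n3 e i).
  exact: (diffO_Fdefect_add (p := 2) (q := 2)).
pose b2 e i := b e i + b e i.
have Db2 : diffO h m L 3 b2 by apply: diffOD.
have Dnb2 : diffO h m L 4
    (fun e i => Fdefect 2^-1 b2 e i - Fdefect 2^-1 b e i - Fdefect 2^-1 b e i).
  exact: (diffO_Fdefect_add (p := 3) (q := 3)).
pose g e i := b2 e i + a4 e i.
have Dg : diffO h m L 4 g.
  have Q : diffO h m L 4 _ := @diffO_exact_thirds 5 (-4) (-1) 1 2 0 4 isT
    ltac:(vanishing_moments).
  have Dh := diffO_hscale (diffOB Dnb (weak 4 3 _ isT Dn23)).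
  have Dl := diffOD Q (diffOZ 5 Da1).
  apply: diffO_eq (diffOD (diffOD Dl (weak 5 4 _ isT Dhn1)) Dh) => e i _.
  by rewrite /g /b2 /b /a2 /a3 /a4 /Y2 /Y3 /Y4 K1E K2E K3E /a1; lmod R; field.
have Dng : diffO h m L 4 (Fdefect 2^-1 g) by apply: diffO_Fdefect.
have Dng' : diffO h m L 4 (fun e i => Fdefect 2^-1 g e i - Fdefect 2^-1 b2 e i
    - Fdefect 2^-1 a4 e i).
  exact: (diffO_Fdefect_add (p := 3) (q := 3)).
have Dmv : diffO h m L 4 (fun e i => n4 e i - Fdefect 2^-1 a4 e i).
  exact: diffO_Fdefect_move.
have DS : diffO h m L 4 (fun e i => n1 e i + 2 *: n2 e i + 2 *: n3 e i + n4 e i).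
  apply: diffO_eq (diffOB (diffOD (diffOD Dn1 Dng) Dmv)
    (diffOD (diffOD (diffOZ 2 Dn23) Dnb2) Dng')) => e i _.
  by lmod R; ring.
have Q : diffO h m L 5 _ := @diffO_exact_thirds 1 0 (-1) 6^-1 (4 / 6) 6^-1 5 isT
  ltac:(vanishing_moments).
apply: diffO_eq (diffOD Q (diffOZ 6^-1 (diffO_hscale DS))) => e i _.
by rewrite rkE K1E K2E K3E K4E; lmod R; field.
Qed.

End Step.
Definition rk4_error (e : I) (i : nat) : X :=
  rk4 F (h e) (t0 e) (u (t0 e)) i - u (node h t0 e i).

(** Bootstrapping: [m] differences of the error control [m] differences of its
    increment, that is [m + 1] differences of the error. *)
Lemma diffO_rk4_error : diffO h 3 6 4 rk4_error.
Proof.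
have incr m L : (L <= 5)%N -> (m <= 2)%N -> diffO h m L 4 rk4_error ->
    diffO h m L 5 (fun e i => rk4_error e i.+1 - rk4_error e i).
  move=> L5 m2 De.
  have := @diffO_rk4_increment m L L5 m2 (fun e i => rk4 F (h e) (t0 e) (u (t0 e)) i).
  have nodeS e i : node h t0 e i.+1 = node h t0 e i + 1 * h e.
    by rewrite /node -natr1; ring.
  move=> H; apply: diffO_eq (H _) => [e i _|].
    by rewrite /rk4_error nodeS mul0r addr0 /= -/(node h t0 e i); lmod R; ring.
  by apply: diffO_eq De => e i _; rewrite mul0r addr0.
(* The a priori bound O(h^4) propagates from one grid point to the next. *)
have base L : (L <= 6)%N -> stepO h L 4 rk4_error.
  elim: L => [|L IH] L6; first by exists 0.
  have S := IH (ltnW L6).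
  have [C' C0' HC'] := stepO_ge0 h01 (diffO_stepO (incr 0%N L L6 isT (conj S Logic.I))).
  have [C C0 HC] := stepO_ge0 h01 S.
  exists (C + C') => e [_|i].
    rewrite /rk4_error /node mul0r addr0 subrr normr0.
    by case/andP: (h01 e) => /ltW h0 _; rewrite mulr_ge0 ?addr_ge0 ?exprn_ge0.
  rewrite ltnS => iL; have /andP[h0 h1] := h01 e.
  rewrite -[rk4_error e i.+1](subrK (rk4_error e i)) addrC mulrDl.
  apply: le_trans (ler_normD _ _) _; apply: lerD (HC e i iL) _.
  apply: le_trans (HC' e i iL) _; rewrite ler_wpM2l //.
  by rewrite exprS ler_piMl // exprn_ge0 // ltW.
have D0 : diffO h 0 6 4 rk4_error by split=> //; apply: base.
have D1 : diffO h 1 6 4 rk4_error.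
  by split; [case: D0|apply: incr => //; apply: (diffO_narrow h01 _ D0)].
have D2 : diffO h 2 6 4 rk4_error.
  by split; [case: D0|apply: incr => //; apply: (diffO_narrow h01 _ D1)].
by split; [case: D0|apply: incr => //; apply: (diffO_narrow h01 _ D2)].
Qed.

(** The weights of [dc_a] annihilate polynomials of degree 2 in the rank of the
    substep and those of [dc_b] polynomials of degree 1, so that they are
    combinations of third and second differences. *)
Lemma dc_rk4_error : exists C, forall e,
  `|dc_a (rk4_error e)| <= C * h e ^+ 7 /\ `|dc_b (rk4_error e)| <= C * h e ^+ 6.
Proof.
have [_ [_ [S2 [S3 _]]]] := diffO_rk4_error.
have [C2 C20 H2] := stepO_ge0 h01 S2; have [C3 C30 H3] := stepO_ge0 h01 S3.
set w := rk4_error in H2 H3 *.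
exists (6 * C3 + 11 * C2) => e; have /andP[/ltW h0 _] := h01 e.
pose d2 i := w e i.+2 - w e i.+1 - (w e i.+1 - w e i).
pose d3 i := d2 i.+1 - d2 i.
(* The coefficients of the differences below are the iterated partial sums
   of the weights of [dc_a] and [dc_b], up to sign. *)
have {}H2 i : (i < 4)%N -> `|d2 i| <= C2 * h e ^+ 6 := H2 e i.
have {}H3 i : (i < 3)%N -> `|d3 i| <= C3 * h e ^+ 7 := H3 e i.
have h6 : 0 <= h e ^+ 6 by rewrite exprn_ge0.
have h7 : 0 <= h e ^+ 7 by rewrite exprn_ge0.
have c26 : 0 <= C2 * h e ^+ 6 by rewrite mulr_ge0.
have c27 : 0 <= C2 * h e ^+ 7 by rewrite mulr_ge0.
have c36 : 0 <= C3 * h e ^+ 6 by rewrite mulr_ge0.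
have c37 : 0 <= C3 * h e ^+ 7 by rewrite mulr_ge0.
split.
  rewrite (_ : dc_a _ = (125 / 384) *: (3 *: d3 0%N + 10 *: d3 1%N + 3 *: d3 2%N));
    last by rewrite /dc_a /d3 /d2; lmod R; field.
  rewrite normrZ ger0_norm; last by lra.
  have := ler_normD (3 *: d3 0%N + 10 *: d3 1%N) (3 *: d3 2%N).
  have := ler_normD (3 *: d3 0%N) (10 *: d3 1%N).
  rewrite !normrZ !normr_nat.
  by have := H3 0%N isT; have := H3 1%N isT; have := H3 2%N isT; lra.
rewrite (_ : dc_b _ = (25 / 768) *:
  (145 *: d2 0%N + (- 97) *: d2 1%N + 63 *: d2 2%N + (- 15) *: d2 3%N));
    last by rewrite /dc_b /d2; lmod R; field.
rewrite normrZ ger0_norm; last by lra.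
have := ler_normD (145 *: d2 0%N + (- 97) *: d2 1%N + 63 *: d2 2%N) ((- 15) *: d2 3%N).
have := ler_normD (145 *: d2 0%N + (- 97) *: d2 1%N) (63 *: d2 2%N).
have := ler_normD (145 *: d2 0%N) ((- 97) *: d2 1%N).
rewrite !normrZ !normrN !normr_nat.
by have := H2 0%N isT; have := H2 1%N isT; have := H2 2%N isT; have := H2 3%N isT; lra.
Qed.

End RungeKutta.

(** * Taylor's formula for the vector field *)

Section FieldTaylor.
Variables (R : realType) (X : normedModType R) (T M mu : R) (u : R -> X).
Variables (F : R * X -> X) (U : nat -> R -> X).
Hypothesis mu0 : 0 <= mu.
Hypothesis hLip : forall (t : R) (x y : X), t \in `[0, T] ->
  `|F (t, x) - F (t, y)| <= mu * `|x - y|.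
Hypothesis T0 : 0 < T.
Hypothesis jU : jet 7 0 T M U.
Hypothesis U0 : forall t : R, 0 <= t <= T -> U 0%N t = u t.
Hypothesis U1 : forall t : R, 0 <= t <= T -> U 1%N t = F (t, u t).
Hypothesis hF : class_C 6 [set p : R * X | p.1 \in `[0, T]] F.

Let D := [set p : R * X | 0 <= p.1 <= T].

(** The remainder estimate holds for every increment that stays in the time
    interval, not only for small ones: far from the curve both [F], by the
    Lipschitz condition, and the polynomial are dominated by [`|z| ^+ 6]. *)
Lemma vector_field_taylor :
  exists (A : forall j : nat, R * X -> ('I_j -> R * X) -> X) (B : R),
  (forall j t, (j < 6)%N -> 0 <= t <= T ->
     multilinear_map (A j (t, u t)) /\ opnorm_le B (A j (t, u t))) /\
  (forall t z, 0 <= t <= T -> D ((t, u t) + z) ->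
    `|F ((t, u t) + z) - \sum_(j < 6) j`!%:R^-1 *: A j (t, u t) (fun=> z)|
      <= B * `|z| ^+ 6).
Proof.
have [dU bU] := jU.
have cvxD p q s : p.1 \in `[0, T] -> q.1 \in `[0, T] -> 0 <= s <= 1 ->
    (p + s *: (q - p) : R * X).1 \in `[0, T].
  rewrite !in_itv /= => /andP[p0 pT] /andP[q0 qT] /andP[s0 s1].
  by rewrite /GRing.scale /=; apply/andP; split; nra.
have Dc t : 0 <= t <= T -> ((t, u t) : R * X).1 \in `[0, T] by rewrite in_itv.
have lipc s t : 0 <= s <= T -> 0 <= t <= T ->
    `|(t, u t) - (s, u s)| <= (1 + `|M|) * `|t - s|.
  move=> sT tT; rewrite prod_normE ge_max /= mulrDl mul1r; apply/andP; split.
    by rewrite lerDl mulr_ge0.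
  rewrite -!U0 //; apply: le_trans (jet_lipschitz jU isT sT tT) _.
  by apply: le_trans (ler_wpM2r (normr_ge0 _) (ler_norm M)) _; rewrite lerDr.
have [A [d [d0 mulA taylorA]]] :=
  class_C_taylor (c := fun t => (t, u t)) hF cvxD Dc lipc.
have M0 : 0 <= M by apply: le_trans (normr_ge0 _) (bU 0%N 0 isT _); rewrite lexx ltW.
(* [K] bounds [F] and its Taylor polynomial at distance [|z|] from the curve,
   in units of [rho ^+ 6] where [rho = |z| / r >= 1]. *)
pose K := M + mu * (2 * M + 1) + 6 * d^-1.
pose r := Num.min d 1.
have r0 : 0 < r by rewrite lt_min d0 ltr01.
have [rd r1] : r <= d /\ r <= 1 by rewrite /r !ge_min !lexx orbT.
have di0 : 0 <= d^-1 by rewrite invr_ge0 ltW.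
have K0 : 0 <= K by rewrite /K !addr_ge0 // mulr_ge0 // addr_ge0 // mulr_ge0.
have Kr0 : 0 <= K / r ^+ 6 by rewrite divr_ge0 // exprn_ge0 // ltW.
exists A, (d^-1 + K / r ^+ 6); split=> [j t j6 tT|t z tT Dz].
  have [mA bA] := mulA j t (ltnW j6) tT; split=> //.
  by apply: opnorm_leW bA; rewrite lerDl.
have z60 : 0 <= `|z| ^+ 6 by rewrite exprn_ge0.
have [zd|dz] := ltP `|z| d.
  have Dz' : ((t, u t) + z).1 \in `[0, T] by rewrite in_itv.
  apply: le_trans (taylorA t z tT Dz' zd) _.
  by rewrite ler_wpM2r // lerDl.
pose rho := `|z| / r.
have rho1 : 1 <= rho by rewrite ler_pdivlMr // mul1r (le_trans rd).
have rho6 j : (j <= 6)%N -> `|z| ^+ j <= rho ^+ 6.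
  move=> j6; apply: (@le_trans _ _ (rho ^+ j)); last by rewrite ler_weXn2l.
  rewrite lerXn2r ?nnegrE ?mulr_ge0 ?invr_ge0 ?(ltW r0) //.
  by rewrite ler_pdivlMr // ler_piMr.
have -> : (d^-1 + K / r ^+ 6) * `|z| ^+ 6 = d^-1 * `|z| ^+ 6 + K * rho ^+ 6.
  by rewrite /rho expr_div_n; ring.
apply: (@le_trans _ _ (K * rho ^+ 6)); last by rewrite lerDr mulr_ge0 // invr_ge0 ltW.
have sT : 0 <= t + z.1 <= T := Dz.
have zE : (t, u t) + z = (t + z.1, u t + z.2) by [].
have F1 : `|F ((t, u t) + z)| <= M + mu * (2 * M + `|z|).
  rewrite zE -[F _](subrK (F (t + z.1, u (t + z.1)))).
  apply: le_trans (ler_normD _ _) _; rewrite addrC; apply: lerD.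
    by rewrite -U1 // bU.
  apply: le_trans (hLip _ _ _) _; first by rewrite in_itv.
  rewrite ler_wpM2l //; apply: le_trans (ler_normB _ _) _.
  have := ler_normD (u t) z.2.
  have : `|z.2| <= `|z| by rewrite [leRHS]prod_normE le_max lexx orbT.
  by have := bU 0%N t isT tT; have := bU 0%N _ isT sT; rewrite !U0 //; lra.
have F2 : `|\sum_(j < 6) j`!%:R^-1 *: A j (t, u t) (fun=> z)| <= 6 * d^-1 * rho ^+ 6.
  apply: le_trans (ler_norm_sum _ _ _) _.
  have -> : 6 * d^-1 * rho ^+ 6 = \sum_(j < 6) d^-1 * rho ^+ 6.
    by rewrite sumr_const card_ord -mulrA mulr_natl.
  apply: ler_sum => j _; have [_ bA] := mulA j t (ltnW (ltn_ord j)) tT.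
  rewrite normrZ; apply: le_trans (ler_piMl (normr_ge0 _) _) _.
    rewrite ger0_norm ?invr_ge0 // invf_le1 ?ltr0n ?fact_gt0 //.
    by rewrite ler1n fact_gt0.
  apply: le_trans (bA _) _; rewrite prodr_const card_ord.
  by rewrite ler_wpM2l ?invr_ge0 ?(ltW d0) // rho6 // ltnW.
apply: le_trans (ler_normB _ _) _; rewrite /K mulrDl; apply: lerD F2.
apply: le_trans F1 _; have := rho6 0%N isT; have := rho6 1%N isT.
rewrite expr0 expr1 => z1 one; rewrite [leRHS]mulrDl; apply: lerD.
  by rewrite ler_peMr.
by rewrite -mulrA ler_wpM2l // [leRHS]mulrDl mul1r lerD // ler_peMr ?mulr_ge0.
Qed.

End FieldTaylor.

(** * Stability of one step *)

Section Stability.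
Variables (R : realType) (X : normedModType R) (T mu : R) (F : R * X -> X).
Hypothesis mu0 : 0 <= mu.
Hypothesis hLip : forall (t : R) (x y : X), t \in `[0, T] ->
  `|F (t, x) - F (t, y)| <= mu * `|x - y|.

Lemma rk4_step_stable : exists2 c, 0 <= c & forall (h s : R) (v w : X),
  0 <= h <= 1 -> 0 <= s -> s + h <= T ->
  `|(rk4_step F h s v - rk4_step F h s w) - (v - w)| <= c * h * `|v - w|.
Proof.
pose m1 := 1 + mu; have m10 : 0 <= m1 by rewrite addr_ge0.
exists (mu * m1 ^+ 3); first by rewrite mulr_ge0 // exprn_ge0.
move=> h s v w /andP[h0 h1] s0 shT.
have sI : s \in `[0, T] by rewrite in_itv /=; apply/andP; split; lra.
have hI : s + h / 2 \in `[0, T] by rewrite in_itv /=; apply/andP; split; lra.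
have nI : s + h \in `[0, T] by rewrite in_itv /=; apply/andP; split; lra.
set d := `|v - w|; have d0 : 0 <= d by rewrite normr_ge0.
have m11 : 1 <= m1 by rewrite lerDl.
have m1P P : 0 <= P -> P <= m1 * P by move=> P0; rewrite ler_peMl.
have stage t q (x y : X) P : t \in `[0, T] -> 0 <= q <= 1 -> d <= P ->
    `|x - y| <= mu * P ->
    `|F (t, v + q *: x) - F (t, w + q *: y)| <= mu * (m1 * P).
  move=> tI /andP[q0 q1] dP xy; apply: le_trans (hLip _ _ tI) _.
  rewrite ler_wpM2l //.
  rewrite (_ : _ - _ = (v - w) + q *: (x - y)); last by lmod R; ring.
  apply: le_trans (ler_normD _ _) _; rewrite normrZ ger0_norm // /m1 mulrDl mul1r.
  by apply: lerD => //; apply: le_trans xy; rewrite ler_piMl.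
rewrite /rk4_step; set K1 := F (s, v); set L1 := F (s, w).
set K2 := F (_, v + (h / 2) *: K1); set L2 := F (_, w + (h / 2) *: L1).
set K3 := F (_, v + (h / 2) *: K2); set L3 := F (_, w + (h / 2) *: L2).
set K4 := F (_, v + h *: K3); set L4 := F (_, w + h *: L3).
have h2 : 0 <= h / 2 <= 1 by apply/andP; split; lra.
have P1 : 0 <= m1 * d by rewrite mulr_ge0.
have P2 : 0 <= m1 * (m1 * d) by rewrite mulr_ge0.
have D1 : d <= m1 * d by apply: m1P.
have D2 : m1 * d <= m1 * (m1 * d) by apply: m1P.
have D3 : m1 * (m1 * d) <= m1 * (m1 * (m1 * d)) by apply: m1P.
have E1 : `|K1 - L1| <= mu * d by apply: hLip.
have E2 : `|K2 - L2| <= mu * (m1 * d) by apply: stage.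
have E3 : `|K3 - L3| <= mu * (m1 * (m1 * d)) by apply: stage.
have E4 : `|K4 - L4| <= mu * (m1 * (m1 * (m1 * d))).
  by apply: stage => //; [rewrite h0|lra].
rewrite (_ : _ - _ = (h / 6) *: ((K1 - L1) + 2 *: (K2 - L2) + 2 *: (K3 - L3) + (K4 - L4)));
  last by lmod R; ring.
rewrite normrZ ger0_norm; last by lra.
have -> : mu * m1 ^+ 3 * h * d = h / 6 * (6 * (mu * (m1 * (m1 * (m1 * d))))) by field.
rewrite ler_wpM2l //; first by lra.
have := ler_normD (K1 - L1 + 2 *: (K2 - L2) + 2 *: (K3 - L3)) (K4 - L4).
have := ler_normD (K1 - L1 + 2 *: (K2 - L2)) (2 *: (K3 - L3)).
have := ler_normD (K1 - L1) (2 *: (K2 - L2)).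
rewrite !normrZ !ger0_norm //.
have := ler_wpM2l mu0 D1; have := ler_wpM2l mu0 D2; have := ler_wpM2l mu0 D3.
lra.
Qed.

(** 15, like 42 for [dc_b], exceeds the sum of the absolute values of the
    weights. *)
Lemma dc_a_le (w : nat -> X) B : (forall i, (i <= 5)%N -> `|w i| <= B) ->
  `|dc_a w| <= 15 * B.
Proof.
move=> wB; rewrite /dc_a normrZ ger0_norm; last by lra.
have := ler_normD ((- 3) *: w 0%N - w 1%N + 18 *: w 2%N - 18 *: w 3%N + w 4%N)
  (3 *: w 5%N).
have := ler_normD ((- 3) *: w 0%N - w 1%N + 18 *: w 2%N - 18 *: w 3%N) (w 4%N).
have := ler_normB ((- 3) *: w 0%N - w 1%N + 18 *: w 2%N) (18 *: w 3%N).
have := ler_normD ((- 3) *: w 0%N - w 1%N) (18 *: w 2%N).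
have := ler_normB ((- 3) *: w 0%N) (w 1%N).
rewrite !normrZ !normrN !normr_nat.
have := wB 0%N isT; have := wB 1%N isT; have := wB 2%N isT.
have := wB 3%N isT; have := wB 4%N isT; have := wB 5%N isT.
have := normr_ge0 (w 0%N); lra.
Qed.

Lemma dc_b_le (w : nat -> X) B : (forall i, (i <= 5)%N -> `|w i| <= B) ->
  `|dc_b w| <= 42 * B.
Proof.
move=> wB; rewrite /dc_b normrZ ger0_norm; last by lra.
have := ler_normB (145 *: w 0%N - 387 *: w 1%N + 402 *: w 2%N - 238 *: w 3%N
  + 93 *: w 4%N) (15 *: w 5%N).
have := ler_normD (145 *: w 0%N - 387 *: w 1%N + 402 *: w 2%N - 238 *: w 3%N)
  (93 *: w 4%N).
have := ler_normB (145 *: w 0%N - 387 *: w 1%N + 402 *: w 2%N) (238 *: w 3%N).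
have := ler_normD (145 *: w 0%N - 387 *: w 1%N) (402 *: w 2%N).
have := ler_normB (145 *: w 0%N) (387 *: w 1%N).
rewrite !normrZ !normr_nat.
have := wB 0%N isT; have := wB 1%N isT; have := wB 2%N isT.
have := wB 3%N isT; have := wB 4%N isT; have := wB 5%N isT.
have := normr_ge0 (w 0%N); lra.
Qed.

Lemma dc_aB (x y : nat -> X) : dc_a (fun i => x i - y i) = dc_a x - dc_a y.
Proof. by rewrite /dc_a; lmod R; field. Qed.

Lemma dc_bB (x y : nat -> X) : dc_b (fun i => x i - y i) = dc_b x - dc_b y.
Proof. by rewrite /dc_b; lmod R; field. Qed.

(** All the substeps move two initial values nearly in parallel; since [dc_a]
    annihilates constants, only the small deviation enters it. *)
Lemma rk4_stable : exists2 c, 0 <= c & forall (h s : R) (v w : X) i,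
  0 <= h <= 1 -> 0 <= s -> s + 5 * h <= T -> (i <= 5)%N ->
  `|(rk4 F h s v i - rk4 F h s w i) - (v - w)| <= c * h * `|v - w|.
Proof.
have [c c0 Hc] := rk4_step_stable.
have c1 : 1 <= 1 + c by rewrite lerDl.
exists ((1 + c) ^+ 5 - 1); first by rewrite subr_ge0 exprn_ege1.
move=> h s v w i /andP[h0 h1] s0 sT i5.
apply: (@le_trans _ _ (((1 + c) ^+ i - 1) * h * `|v - w|)); last first.
  by rewrite !ler_wpM2r // lerD2r ler_weXn2l.
elim: i i5 => [|i IH] i5 /=; first by rewrite expr0 !subrr !mul0r normr0.
have {}IH := IH (ltnW i5).
set x := rk4 F h s v i in IH *; set y := rk4 F h s w i in IH *.
have step : `|rk4_step F h (s + i%:R * h) x - rk4_step F h (s + i%:R * h) y - (x - y)|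
    <= c * h * `|x - y|.
  apply: Hc; first by rewrite h0.
    by rewrite addr_ge0 // mulr_ge0.
  apply: le_trans sT; rewrite -addrA lerD2l.
  have : i.+1%:R <= 5 :> R by rewrite (ler_nat _ i.+1 5).
  by rewrite -[i.+1%:R]natr1; nra.
have e0 : 0 <= (1 + c) ^+ i - 1 by rewrite subr_ge0 exprn_ege1.
have xy : `|x - y| <= (1 + c) ^+ i * `|v - w|.
  rewrite -[x - y](subrK (v - w)); apply: le_trans (ler_normD _ _) _.
  rewrite -[(1 + c) ^+ i](subrK 1) mulrDl mul1r lerD2r; apply: le_trans IH _.
  by rewrite ler_wpM2r // ler_piMr.
have split_diff (p q : X) : p - q - (v - w) = (p - q - (x - y)) + (x - y - (v - w)).
  by lmod R; ring.
rewrite split_diff; apply: le_trans (ler_normD _ _) _.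
rewrite (_ : (_ - 1) * h * _ = c * h * ((1 + c) ^+ i * `|v - w|)
    + ((1 + c) ^+ i - 1) * h * `|v - w|); last by rewrite exprS; ring.
by apply: lerD IH; apply: le_trans step _; rewrite ler_wpM2l // mulr_ge0.
Qed.

Lemma dc6rk24_step_stable : exists2 c, 0 <= c & forall (k t : R) (v w : X),
  0 <= k <= 1 -> 0 <= t -> t + k <= T ->
  `|dc6rk24_step F k t v - dc6rk24_step F k t w| <= (1 + c * k) * `|v - w|.
Proof.
have [c c0 Hc] := rk4_stable.
exists (15 * c + mu * (1 + mu + 42 * (1 + c))).
  by rewrite addr_ge0 ?mulr_ge0 ?addr_ge0 ?mulr_ge0 ?addr_ge0.
move=> k t v w /andP[k0 k1] t0 tkT.
have h01 : 0 <= k / 5 <= 1 by apply/andP; split; lra.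
have tT : t + 5 * (k / 5) <= T by rewrite mulrC divfK.
set d := `|v - w|; have d0 : 0 <= d by rewrite normr_ge0.
pose x i := rk4 F (k / 5) t v i - rk4 F (k / 5) t w i.
have ax : dc_a x = dc_a (rk4 F (k / 5) t v) - dc_a (rk4 F (k / 5) t w) := dc_aB _ _.
have bx : dc_b x = dc_b (rk4 F (k / 5) t v) - dc_b (rk4 F (k / 5) t w) := dc_bB _ _.
have xd i : (i <= 5)%N -> `|x i - (v - w)| <= c * (k / 5) * d by apply: Hc.
have ckd : 0 <= c * k * d by rewrite !mulr_ge0.
have xle i : (i <= 5)%N -> `|x i| <= (1 + c) * d.
  move=> i5; rewrite -[x i](subrK (v - w)); apply: le_trans (ler_normD _ _) _.
  rewrite addrC mulrDl mul1r lerD2l; apply: le_trans (xd i i5) _.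
  by rewrite ler_wpM2r // ler_piMr //; lra.
have A : `|dc_a x| <= 15 * (c * (k / 5) * d).
  rewrite (_ : dc_a x = dc_a (fun i => x i - (v - w))); first exact: dc_a_le.
  by rewrite /dc_a; lmod R; field.
have B : `|dc_b x| <= 42 * ((1 + c) * d) by apply: dc_b_le.
rewrite /dc6rk24_step.
set yv := v + (k / 2) *: F (t, v) + _; set yw := w + (k / 2) *: F (t, w) + _.
have yE : yv - yw = (v - w) + (k / 2) *: (F (t, v) - F (t, w)) + dc_b x.
  by rewrite bx /yv /yw; lmod R; field.
have Fd : `|F (t, v) - F (t, w)| <= mu * d.
  by apply: hLip; rewrite in_itv /=; apply/andP; split; lra.
have Y : `|yv - yw| <= (1 + mu + 42 * (1 + c)) * d.
  rewrite yE; apply: le_trans (ler_normD _ _) _; rewrite mulrDl -[42 * _ * _]mulrA.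
  apply: lerD B; apply: le_trans (ler_normD _ _) _; rewrite mulrDl mul1r lerD2l.
  rewrite normrZ ger0_norm; last by lra.
  by apply: le_trans Fd; rewrite ler_piMl //; lra.
have FY : `|F (t + k / 2, yv) - F (t + k / 2, yw)| <= mu * ((1 + mu + 42 * (1 + c)) * d).
  apply: le_trans (hLip _ _ _) _; last by rewrite ler_wpM2l.
  by rewrite in_itv /=; apply/andP; split; lra.
rewrite (_ : _ - _ = (v - w) + dc_a x
    + k *: (F (t + k / 2, yv) - F (t + k / 2, yw))); last first.
  by rewrite ax; lmod R; field.
have -> : (1 + (15 * c + mu * (1 + mu + 42 * (1 + c))) * k) * d =
  d + 15 * (c * k * d) + k * (mu * ((1 + mu + 42 * (1 + c)) * d)) by ring.
apply: le_trans (ler_normD _ _) _; apply: lerD; last first.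
  by rewrite normrZ ger0_norm // ler_wpM2l.
apply: le_trans (ler_normD _ _) _; rewrite lerD2l; apply: le_trans A _.
lra.
Qed.

End Stability.

(** * Local error and convergence *)

Lemma jet_narrow (R : realType) (X : normedModType R) m n (a b M : R)
    (U : nat -> R -> X) : (m <= n)%N -> jet n a b M U -> jet m a b M U.
Proof.
move=> mn [dU bU]; split=> [j jm|j t jm tab].
  by apply: dU; apply: leq_trans mn.
by apply: bU => //; apply: leq_trans mn.
Qed.

Section LocalError.
Variables (R : realType) (X : normedModType R) (T M mu : R) (u : R -> X).
Variables (F : R * X -> X) (U : nat -> R -> X).
Hypothesis mu0 : 0 <= mu.
Hypothesis hLip : forall (t : R) (x y : X), t \in `[0, T] ->
  `|F (t, x) - F (t, y)| <= mu * `|x - y|.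
Hypothesis T0 : 0 < T.
Hypothesis jU : jet 7 0 T M U.
Hypothesis U0 : forall t : R, 0 <= t <= T -> U 0%N t = u t.
Hypothesis U1 : forall t : R, 0 <= t <= T -> U 1%N t = F (t, u t).
Hypothesis hF : class_C 6 [set p : R * X | p.1 \in `[0, T]] F.

Let grid (k t : R) (i : nat) : X := u (t + i%:R * (k / 5)).

Lemma qsum_order cs ds n : (0 < n)%N -> (n <= 7)%N -> in01 cs -> in01 ds ->
  (forall j, (j < n)%N -> qmoment cs ds j = 0) ->
  exists2 C, 0 <= C & forall (k t : R), 0 <= k -> 0 <= t -> t + k <= T ->
    `|qsum U cs ds t k| <= C * k ^+ n.
Proof.
move=> n0 n7 cs01 ds01 mom0.
have [C HC] := qsum_taylor (jet_narrow n7 jU) n0 cs01 ds01.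
exists `|C| => // k t k0 t0 tkT; have := HC t k k0 t0 tkT.
rewrite big1 ?subr0 => [|j _]; last by rewrite mom0 // mul0r scale0r.
by move/le_trans; apply; rewrite ler_wpM2r ?ler_norm // exprn_ge0.
Qed.

Section Exactness.
Variables (k t : R).
Hypotheses (k0 : 0 <= k) (t_ge0 : 0 <= t) (tkT : t + k <= T).

Let inT (q : R) : 0 <= q <= 1 -> 0 <= t + q * k <= T.
Proof.
move=> /andP[q0 q1]; apply/andP; split; first by rewrite addr_ge0 // mulr_ge0.
by apply: le_trans tkT; rewrite lerD2l ler_piMl.
Qed.

Lemma jet_grid (i : nat) (q : R) : (i <= 5)%N -> q = i%:R / 5 ->
  U 0%N (t + q * k) = grid k t i.
Proof.
move=> i5 qE; rewrite U0; first by rewrite /grid qE; congr (u (_ + _)); field.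
apply: inT; rewrite qE divr_ge0 //= ler_pdivrMr // mul1r.
by rewrite (ler_nat R i 5).
Qed.

Lemma jet_half : U 0%N (t + 1 / 2 * k) = u (t + k / 2).
Proof.
rewrite U0; first by congr (u (_ + _)); field.
by apply: inT; apply/andP; split; lra.
Qed.

Lemma jet1_half : U 1%N (t + 1 / 2 * k) = F (t + k / 2, u (t + k / 2)).
Proof.
have <- : t + 1 / 2 * k = t + k / 2 by field.
by rewrite U1 //; apply: inT; apply/andP; split; lra.
Qed.

End Exactness.

(** The functional is exact on polynomials of degree 6 although it uses six
    points: its weights are antisymmetric around the midpoint. *)
Lemma dc_a_exact : exists2 C, 0 <= C & forall (k t : R),
  0 <= k -> 0 <= t -> t + k <= T ->
  `|u t + dc_a (grid k t) + k *: F (t + k / 2, u (t + k / 2)) - u (t + k)|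
    <= C * k ^+ 7.
Proof.
pose cs : seq (R * R) := [:: (0 / 5, 1 - 375 / 384); (1 / 5, - (125 / 384));
  (2 / 5, 2250 / 384); (3 / 5, - (2250 / 384)); (4 / 5, 125 / 384);
  (5 / 5, 375 / 384 - 1)].
pose ds : seq (R * R) := [:: (1 / 2, 1)].
have cs01 : in01 cs by rewrite /in01 /=; do ![apply/andP; split]; rewrite //; lra.
have ds01 : in01 ds by rewrite /in01 /=; do ![apply/andP; split]; rewrite //; lra.
have mom : forall j, (j < 7)%N -> qmoment cs ds j = 0 by vanishing_moments.
have [C C0 HC] := @qsum_order cs ds 7 isT isT cs01 ds01 mom.
exists C => // k t k0 t0 tkT; apply: le_trans (HC k t k0 t0 tkT).
rewrite le_eqVlt; apply/orP; left; apply/eqP; congr (`|_|).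
rewrite /qsum !(big_cons, big_nil) /=.
rewrite (jet_grid k0 t0 tkT (i := 0)) // (jet_grid k0 t0 tkT (i := 1)) //.
rewrite (jet_grid k0 t0 tkT (i := 2)) // (jet_grid k0 t0 tkT (i := 3)) //.
rewrite (jet_grid k0 t0 tkT (i := 4)) // (jet_grid k0 t0 tkT (i := 5)) //.
rewrite jet1_half // /dc_a.
have -> : u t = grid k t 0 by rewrite /grid mul0r addr0.
have -> : u (t + k) = grid k t 5 by congr (u (_ + _)); field.
by set f := F (_, _); lmod R; field.
Qed.

Lemma dc_b_exact : exists2 C, 0 <= C & forall (k t : R),
  0 <= k -> 0 <= t -> t + k <= T ->
  `|u t + (k / 2) *: F (t, u t) + dc_b (grid k t) - u (t + k / 2)| <= C * k ^+ 6.
Proof.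
pose cs : seq (R * R) := [:: (0 / 5, 1 + 25 * 145 / 768); (1 / 5, - (25 * 387 / 768));
  (2 / 5, 25 * 402 / 768); (3 / 5, - (25 * 238 / 768)); (4 / 5, 25 * 93 / 768);
  (5 / 5, - (25 * 15 / 768)); (1 / 2, - 1)].
pose ds : seq (R * R) := [:: (0 / 5, 1 / 2)].
have cs01 : in01 cs by rewrite /in01 /=; do ![apply/andP; split]; rewrite //; lra.
have ds01 : in01 ds by rewrite /in01 /=; do ![apply/andP; split]; rewrite //; lra.
have mom : forall j, (j < 6)%N -> qmoment cs ds j = 0 by vanishing_moments.
have [C C0 HC] := @qsum_order cs ds 6 isT isT cs01 ds01 mom.
exists C => // k t k0 t0 tkT; apply: le_trans (HC k t k0 t0 tkT).
rewrite le_eqVlt; apply/orP; left; apply/eqP; congr (`|_|).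
rewrite /qsum !(big_cons, big_nil) /=.
have -> : U 1%N (t + 0 / 5 * k) = F (t, u t).
  by rewrite !mul0r addr0 U1 // t0; lra.
rewrite (jet_grid k0 t0 tkT (i := 0)) // (jet_grid k0 t0 tkT (i := 1)) //.
rewrite (jet_grid k0 t0 tkT (i := 2)) // (jet_grid k0 t0 tkT (i := 3)) //.
rewrite (jet_grid k0 t0 tkT (i := 4)) // (jet_grid k0 t0 tkT (i := 5)) //.
rewrite jet_half // /dc_b.
have -> : u t = grid k t 0 by rewrite /grid mul0r addr0.
by lmod R; field.
Qed.

(** The Runge-Kutta values are the exact ones plus an error that [dc_a] and
    [dc_b] damp to O(k^7) and O(k^6); the latter is multiplied by [k mu] when it
    passes through [F]. *)
Lemma local_error : exists2 C, 0 <= C & forall (k t : R),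
  0 < k <= 1 -> 0 <= t -> t + k <= T ->
  `|dc6rk24_step F k t (u t) - u (t + k)| <= C * k ^+ 7.
Proof.
have [A [B [mulA taylorA]]] := vector_field_taylor mu0 hLip T0 jU U0 U1 hF.
pose I := sig (fun q : R * R => 0 < q.2 <= 1 /\ (0 <= q.1 /\ q.1 + 5 * q.2 <= T)).
pose h (e : I) := (sval e).2; pose t0 (e : I) := (sval e).1.
have h01 e : 0 < h e <= 1 by case: (svalP e).
have t0ge e : 0 <= t0 e by case: (svalP e) => _ [].
have t0le e : t0 e + 5 * h e <= T by case: (svalP e) => _ [].
have [C1 H1] := dc_rk4_error jU U0 U1 mulA taylorA h01 t0ge t0le.
have [Ca Ca0 Ha] := dc_a_exact. have [Cb Cb0 Hb] := dc_b_exact.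
exists (`|C1| + Ca + mu * (`|C1| + Cb)).
  by rewrite !addr_ge0 // mulr_ge0 // addr_ge0.
move=> k t /andP[k0 k1] t_ge0 tkT.
have ok : 0 < k / 5 <= 1 /\ (0 <= t /\ t + 5 * (k / 5) <= T).
  by split; [apply/andP; split; lra|split; lra].
pose w := rk4 F (k / 5) t (u t).
pose err i := w i - grid k t i.
have k6 : 0 <= k ^+ 6 by rewrite exprn_ge0 // ltW.
have k7 : 0 <= k ^+ 7 by rewrite exprn_ge0 // ltW.
have shrink n : `|C1| * (k / 5) ^+ n <= `|C1| * k ^+ n.
  by rewrite ler_wpM2l // lerXn2r ?nnegrE //; lra.
have [Ea Eb] : `|dc_a err| <= `|C1| * k ^+ 7 /\ `|dc_b err| <= `|C1| * k ^+ 6.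
  have [Ea Eb] := H1 (exist _ (t, k / 5) ok).
  split; [apply: le_trans Ea _|apply: le_trans Eb _].
    apply: le_trans (shrink 7%N); rewrite ler_wpM2r ?ler_norm // exprn_ge0 //.
    by case/andP: (h01 (exist _ (t, k / 5) ok)) => /ltW.
  apply: le_trans (shrink 6%N); rewrite ler_wpM2r ?ler_norm // exprn_ge0 //.
  by case/andP: (h01 (exist _ (t, k / 5) ok)) => /ltW.
have aE : dc_a err = dc_a w - dc_a (grid k t) := dc_aB _ _.
have bE : dc_b err = dc_b w - dc_b (grid k t) := dc_bB _ _.
rewrite /dc6rk24_step -/w.
set y := u t + (k / 2) *: F (t, u t) + dc_b w.
have Y : `|y - u (t + k / 2)| <= (`|C1| + Cb) * k ^+ 6.
  have -> : y - u (t + k / 2) = dc_b err +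
      (u t + (k / 2) *: F (t, u t) + dc_b (grid k t) - u (t + k / 2)).
    by rewrite bE /y; lmod R; field.
  rewrite mulrDl; apply: le_trans (ler_normD _ _) (lerD Eb _).
  by apply: Hb => //; apply: ltW.
have FY : `|F (t + k / 2, y) - F (t + k / 2, u (t + k / 2))|
    <= mu * ((`|C1| + Cb) * k ^+ 6).
  apply: le_trans (hLip _ _ _) _; last by rewrite ler_wpM2l.
  by rewrite in_itv /=; apply/andP; split; lra.
have -> : u t + dc_a w + k *: F (t + k / 2, y) - u (t + k) = dc_a err +
   (u t + dc_a (grid k t) + k *: F (t + k / 2, u (t + k / 2)) - u (t + k)) +
   k *: (F (t + k / 2, y) - F (t + k / 2, u (t + k / 2))).
  by rewrite aE; lmod R; ring.
rewrite [leRHS]mulrDl; apply: le_trans (ler_normD _ _) _; apply: lerD.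
  rewrite mulrDl; apply: le_trans (ler_normD _ _) (lerD Ea _).
  by apply: Ha => //; apply: ltW.
rewrite normrZ (gtr0_norm k0) exprS.
have -> : mu * (`|C1| + Cb) * (k * k ^+ 6) = k * (mu * ((`|C1| + Cb) * k ^+ 6)) by ring.
by rewrite ler_wpM2l // ltW.
Qed.
End LocalError.

Theorem theorem2 (R : realType) (X : completeNormedModType R) (T : R) (u0 : X)
    (F : R * X -> X) (u : R -> X) (mu : R)
    (hT : 0 < T)
    (hF : class_C 6 [set p : R * X | p.1 \in `[0, T]] F)
    (hmu : 0 <= mu)
    (hLip : forall (t : R) (x y : X), t \in `[0, T] ->
       `|F (t, x) - F (t, y)| <= mu * `|x - y|)
    (hu : cauchy_solution T F u0 u)
    (hu_unique : forall v : R -> X, cauchy_solution T F u0 v ->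
       forall t, t \in `[0, T] -> v t = u t)
    (hu7 : class_C 7 [set` `[0, T]] u) :
  exists C k0 : R, 0 < k0 /\
    forall N : nat, (0 < N)%N ->
      let k := T / N%:R in
      k <= k0 ->
      forall n : nat, (n <= N)%N ->
        `|dc6rk24 F k u0 n - u (n%:R * k)| <= C * k ^+ 6.
Proof.
have [U [M [U0 jU]]] := class_C_jet hu7.
have U1 := jet_ode hT (ltn0Sn 6) jU U0 hu.
have [C C0 Hloc] := local_error hmu hLip hT jU U0 U1 hF.
have [c c0 Hst] := dc6rk24_step_stable hmu hLip.
exists (C * T * expR (c * T)), 1; split=> // N N0 k k1 n nN.
have k0 : 0 < k by rewrite divr_gt0 // ltr0n.
have NkT : N%:R * k = T by rewrite mulrC divfK // pnatr_eq0 -lt0n.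
have nkT m : (m <= N)%N -> m%:R * k <= T.
  by move=> mN; rewrite -NkT ler_wpM2r ?ler_nat // ltW.
have q1 : 1 <= 1 + c * k by rewrite lerDl mulr_ge0 // ltW.
have k7 : 0 <= C * k ^+ 7 by rewrite mulr_ge0 // exprn_ge0 // ltW.
(* Discrete Gronwall inequality: each of the [n] local errors is amplified at
   most [n] times by [1 + c k]. *)
have E : `|dc6rk24 F k u0 n - u (n%:R * k)| <= C * k ^+ 7 * n%:R * (1 + c * k) ^+ n.
  elim: n nN => [_|n IH nN].
    by rewrite mul0r /= (proj1 hu) subrr normr0 mulr0 mul0r.
  have {}IH := IH (ltnW nN).
  have tk : n.+1%:R * k = n%:R * k + k by rewrite -natr1 mulrDl mul1r.
  have tkT : n%:R * k + k <= T by rewrite -tk nkT.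
  have t0 : 0 <= n%:R * k by rewrite mulr_ge0 // ltW.
  have kk : 0 < k <= 1 by rewrite k0.
  have kk' : 0 <= k <= 1 by rewrite ltW.
  rewrite tk /=; set v := dc6rk24 F k u0 n in IH *.
  rewrite (_ : _ - _ = (dc6rk24_step F k (n%:R * k) v
      - dc6rk24_step F k (n%:R * k) (u (n%:R * k)))
      + (dc6rk24_step F k (n%:R * k) (u (n%:R * k)) - u (n%:R * k + k)));
    last by rewrite addrA subrK.
  apply: le_trans (ler_normD _ _) _.
  apply: (@le_trans _ _ ((1 + c * k) * (C * k ^+ 7 * n%:R * (1 + c * k) ^+ n)
      + C * k ^+ 7)).
    apply: lerD (Hloc _ _ kk t0 tkT).
    apply: le_trans (Hst _ _ _ _ kk' t0 tkT) _.
    by rewrite ler_wpM2l // (le_trans ler01).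
  have -> : C * k ^+ 7 * n.+1%:R * (1 + c * k) ^+ n.+1 =
      (1 + c * k) * (C * k ^+ 7 * n%:R * (1 + c * k) ^+ n)
      + C * k ^+ 7 * (1 + c * k) ^+ n.+1.
    by rewrite -[n.+1%:R]natr1 [_ ^+ n.+1]exprS; set q := (_ ^+ n); ring.
  by rewrite lerD2l ler_peMr // exprn_ege1.
apply: le_trans E _.
have -> : C * k ^+ 7 * n%:R * (1 + c * k) ^+ n =
  C * k ^+ 6 * ((n%:R * k) * (1 + c * k) ^+ n).
  by set q := (_ ^+ n); ring.
have -> : C * T * expR (c * T) * k ^+ 6 = C * k ^+ 6 * (T * expR (c * T)) by ring.
rewrite ler_wpM2l //; first by rewrite mulr_ge0 // exprn_ge0 // ltW.
apply: ler_pM; rewrite ?nkT //.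
- by rewrite mulr_ge0 // ltW.
- by rewrite exprn_ge0 // (le_trans ler01).
apply: (@le_trans _ _ (expR (c * k) ^+ n)).
  by rewrite lerXn2r ?nnegrE ?expR_ge0 ?expR_ge1Dx // (le_trans ler01).
rewrite -expRM_natl ler_expR mulrCA.
by rewrite ler_wpM2l // nkT.
Qed.
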